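(* Let $\mathcal X\subset\mathbb R^n$ be open and $k\ge1$. Any non-augmented scalar neural ODE $\Phi\in\mathrm{NODE}^k_{\mathrm N}(\mathcal X,\mathbb R)$ has no critical point, i.e. $\nabla\Phi(x)\ne0$ for all $x\in\mathcal X$. Consequently, for $k\ge1$, $\mathrm{NODE}^k_{\mathrm N}(\mathcal X,\mathbb R)\subset(\mathcal C1)^k(\mathcal X,\mathbb R)$, such that every non-augmented scalar neural ODE (with $k\ge2$) is a Morse function.
   Context: Neural ODE setting. Let $T>0$. Consider the initial value problem $\frac{\mathrm dh}{\mathrm dt}=f(t,h(t))$, $h(0)=a$, with $f:\Omega\to\mathbb R^m$, $\Omega=\Omega_t\times\Omega_h\subset\mathbb R\times\mathbb R^m$ open, with solution $h_a:\mathcal I_a\to\mathbb R^m$ on its maximal (open) interval of existence $\mathcal I_a\subset\Omega_t$. For $k\ge1$, $\mathrm{NODE}^k(\mathcal X,\mathbb R)$ is the set of all maps $\Phi:\mathcal X\to\mathbb R$, $\Phi(x)=\widetilde W\,h_{Wx+b}(T)+\tilde b$, with $W\in\mathbb R^{m\times n}$, $b\in\mathbb R^m$, $\widetilde W\in\mathbb R^{1\times m}$, $\tilde b\in\mathbb R$, with $f\in C^{0,k}(\Omega,\mathbb R^m)$ (continuous in $t$, $k$ times continuously differentiable in $h$), such that $\mathcal A=\{Wx+b:x\in\mathcal X\}\subset\Omega_h$ and $[0,T]\subset\mathcal I_a$ for all $a\in\mathcal A$. The neural ODE is non-augmented if $n\ge m$, $\operatorname{rank}(W)=m$ and $\operatorname{rank}(\widetilde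 W)=1$; $\mathrm{NODE}^k_{\mathrm N}(\mathcal X,\mathbb R)$ is the set of these. $(\mathcal C1)^k(\mathcal X,\mathbb R)$ is the set of $\Phi\in C^k(\mathcal X,\mathbb R)$ with $\nabla\Phi(x)\ne0$ for all $x$. A Morse function is a $C^2$ function all of whose critical points have non-singular Hessian. *)

(* Defs.v *)
(* The reals are an arbitrary [R : realType].
   A map defined on a subset of a space is represented by a total function of
   which only the values on that subset are ever constrained or used. *)
From HB Require Import structures.
From mathcomp Require Import all_boot all_order all_algebra.
From mathcomp Require Import all_classical all_reals all_analysis.
Set Implicit Arguments.
Unset Strict Implicit.
Unset Printing Implicit Defensive.
Import Order.TTheory GRing.Theory Num.Theory.
Import numFieldNormedType.Exports.
Local Open Scope classical_set_scope.
Local Open Scope ring_scope.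

Definition basis_vec (R : realType) (n : nat) (i : 'I_n) : 'cV[R]_n :=
  delta_mx i 0.

(* On the open set [U], all iterated directional derivatives of [f] of order
   at most [k] along the vectors [e i] exist and are continuous.  The family
   [e] is a parameter so that C^k and C^{0,k} are both instances. *)
Fixpoint Ck_along (R : realType) (V W : normedModType R) (p : nat)
    (e : 'I_p -> V) (U : set V) (k : nat) (f : V -> W) : Prop :=
  (forall x, U x -> {for x, continuous f}) /\
  if k is k'.+1 then
    forall i : 'I_p, (forall x, U x -> derivable f x (e i)) /\
                     Ck_along e U k' (fun x => 'D_(e i) f x)
  else True.

Definition Ck (R : realType) (n : nat) (k : nat) (X : set 'cV[R]_n)
    (Phi : 'cV[R]_n -> R) : Prop :=
  Ck_along (@basis_vec R n) X k Phi.

(* C^{0,k}: the partial derivatives in [h] of order at most [k] (order 0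
   being [f] itself) exist and are jointly continuous in [(t, h)]. *)
Definition C0k (R : realType) (m : nat) (k : nat) (Omega : set (R * 'cV[R]_m))
    (f : R * 'cV[R]_m -> 'cV[R]_m) : Prop :=
  Ck_along (fun i : 'I_m => ((0 : R), @basis_vec R m i)) Omega k f.

Definition grad (R : realType) (n : nat) (Phi : 'cV[R]_n -> R) (x : 'cV[R]_n) :
    'cV[R]_n :=
  \col_i 'D_(basis_vec R i) Phi x.

Definition hessian (R : realType) (n : nat) (Phi : 'cV[R]_n -> R)
    (x : 'cV[R]_n) : 'M[R]_n :=
  \matrix_(i, j)
    'D_(basis_vec R i) (fun y => 'D_(basis_vec R j) Phi y) x.

Definition critical_point (R : realType) (n : nat) (Phi : 'cV[R]_n -> R)
    (x : 'cV[R]_n) : Prop :=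
  grad Phi x = 0.

Definition C1class (R : realType) (n : nat) (k : nat) (X : set 'cV[R]_n) :
    set ('cV[R]_n -> R) :=
  [set Phi | Ck k X Phi /\ forall x, X x -> grad Phi x <> 0].

Definition morse (R : realType) (n : nat) (X : set 'cV[R]_n)
    (Phi : 'cV[R]_n -> R) : Prop :=
  Ck 2 X Phi /\
  forall x, X x -> critical_point Phi x -> hessian Phi x \in unitmx.

Definition ivp_solution (R : realType) (m : nat) (Omega_t : set R)
    (Omega_h : set 'cV[R]_m) (f : R * 'cV[R]_m -> 'cV[R]_m) (a : 'cV[R]_m)
    (I : set R) (h : R -> 'cV[R]_m) : Prop :=
  [/\ open I, is_interval I, I 0, h 0 = a &
      forall t, I t ->
        [/\ Omega_t t, Omega_h (h t) & is_derive t 1 h (f (t, h t))]].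

Definition maximal_ivp_solution (R : realType) (m : nat) (Omega_t : set R)
    (Omega_h : set 'cV[R]_m) (f : R * 'cV[R]_m -> 'cV[R]_m) (a : 'cV[R]_m)
    (I : set R) (h : R -> 'cV[R]_m) : Prop :=
  ivp_solution Omega_t Omega_h f a I h /\
  forall (J : set R) (g : R -> 'cV[R]_m),
    ivp_solution Omega_t Omega_h f a J g ->
    I `<=` J -> (forall t, I t -> g t = h t) -> J = I.

(* [Phi] is, on [X], the neural ODE with weights [W, b, Wt, bt] and vector
   field [f]; [h a] and [I a] are the maximal solution with initial value [a]
   and its interval of existence. *)
Definition neural_ode_with (R : realType) (T : R) (n m k : nat)
    (X : set 'cV[R]_n) (W : 'M[R]_(m, n)) (b : 'cV[R]_m)
    (Wt : 'M[R]_(1, m)) (bt : R) (Phi : 'cV[R]_n -> R) : Prop :=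
  exists (Omega_t : set R) (Omega_h : set 'cV[R]_m)
    (f : R * 'cV[R]_m -> 'cV[R]_m)
    (I : 'cV[R]_m -> set R) (h : 'cV[R]_m -> R -> 'cV[R]_m),
    let A := [set W *m x + b | x in X] in
    [/\ open (Omega_t `*` Omega_h),
        C0k k (Omega_t `*` Omega_h) f,
        A `<=` Omega_h,
        (forall a, A a ->
           maximal_ivp_solution Omega_t Omega_h f a (I a) (h a) /\
           [set t | 0 <= t <= T] `<=` I a) &
        forall x, X x -> Phi x = (Wt *m h (W *m x + b) T) 0 0 + bt].

Definition NODE (R : realType) (T : R) (n k : nat) (X : set 'cV[R]_n) :
    set ('cV[R]_n -> R) :=
  [set Phi | exists (m : nat) (W : 'M[R]_(m, n)) (b : 'cV[R]_m)
    (Wt : 'M[R]_(1, m)) (bt : R), neural_ode_with T k X W b Wt bt Phi].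

Definition NODE_N (R : realType) (T : R) (n k : nat) (X : set 'cV[R]_n) :
    set ('cV[R]_n -> R) :=
  [set Phi | exists (m : nat) (W : 'M[R]_(m, n)) (b : 'cV[R]_m)
    (Wt : 'M[R]_(1, m)) (bt : R),
    [/\ neural_ode_with T k X W b Wt bt Phi,
        (m <= n)%N, \rank W = m & \rank Wt = 1%N]].

(* Main.v *)
(* The output of the neural ODE at the input x is Wt h(T) + bt, where h solves
   h' = f(t, h), h(0) = W x + b.  The difference quotients of the flow in x are
   almost solutions of the variational equation y' = D_h f(t, h) y, so by
   Gronwall's inequality they are uniformly Cauchy and their limits are exact
   solutions.  Adjoining y to h gives an ODE whose field has one derivative
   less, and induction on k yields that the output is C^k.
   The gradient is Wt Z(T), where Z solves the matrix variational equation with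
   Z(0) = W.  A solution of a linear ODE vanishing at T vanishes at 0, hence
   ker Z(T) is contained in ker W, Z(T) has rank m like W, and Wt Z(T) = 0
   would force Wt = 0. *)
Require Import Defs.
From HB Require Import structures.
From mathcomp Require Import all_boot all_order all_algebra.
From mathcomp Require Import all_classical all_reals all_analysis.
From mathcomp Require Import ring lra.
Import Order.TTheory GRing.Theory Num.Theory.
Import numFieldNormedType.Exports.
Local Open Scope classical_set_scope.
Local Open Scope ring_scope.
Set Implicit Arguments.
Unset Strict Implicit.
Unset Printing Implicit Defensive.

(** * Gronwall estimates *)

(** No existence theorem for the variational equation is invoked: the hypotheses supply solutions of
    the nonlinear equation on all of [0, T], and a solution of the linear one is produced as the
    limit of their difference quotients. The obstacle is that [f] is controlled only locally: the
    Lipschitz bound and the linearisation hold in a tube around one reference trajectory, whose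
    radius is uniform in time by compactness of [0, T]. A neighbouring trajectory must first be
    shown to stay in that tube, which is the role of [gronwall_bootstrap]. Gronwall's inequality is
    proved in both time directions: the forward one gives convergence, the backward one the
    injectivity of the linear flow. For the induction on [k] to close, the initial value is an
    arbitrary C^k function of the parameter and the dimension [m] is generalised, since each step
    doubles it. *)

Lemma mx_norm_le (R : realType) (m n : nat) (A : 'M[R]_(m, n)) (c : R) :
  0 <= c -> (`|A| <= c) <-> (forall i j, `|A i j| <= c).
Proof.
move=> c0; rewrite [`|A|]/Num.Def.normr/= mx_normrE; split.
  by move=> /bigmax_leP[_ H] i j; exact: (H (i, j)).
by move=> H; apply: bigmax_le => // -[i j] _; exact: H.
Qed.

Lemma mx_norm_entry (R : realType) (m n : nat) (A : 'M[R]_(m, n)) i j :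
  `|A i j| <= `|A|.
Proof. by have [+ _] := mx_norm_le A (normr_ge0 A); apply. Qed.

(** The norm is the sup norm, which need not be differentiable along a curve; the sum of squares is,
    and this comparison lets Gronwall's argument run on it. *)
Lemma cV_norm_sqr_bounds (R : realType) (m : nat) (u : 'cV[R]_m) :
  `|u| ^+ 2 <= \sum_i u i 0 ^+ 2 <= m%:R * `|u| ^+ 2.
Proof.
apply/andP; split; last first.
  apply: le_trans (_ : \sum_(i < m) `|u| ^+ 2 <= _).
    apply: ler_sum => i _; rewrite -[leLHS]ger0_norm ?sqr_ge0// normrX.
    by apply: lerXn2r; rewrite ?nnegrE// mx_norm_entry.
  by rewrite sumr_const card_ord mulr_natl.
have S0 : 0 <= \sum_i u i 0 ^+ 2 by apply: sumr_ge0 => i _; exact: sqr_ge0.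
rewrite -[leRHS](@sqr_sqrtr _ (\sum_i u i 0 ^+ 2))//.
apply: lerXn2r; rewrite ?nnegrE ?sqrtr_ge0//.
apply/mx_norm_le; first exact: sqrtr_ge0.
move=> i j; rewrite (ord1 j) -sqrtr_sqr; apply: ler_wsqrtr.
by rewrite (bigD1 i)//= lerDl; apply: sumr_ge0 => k _; exact: sqr_ge0.
Qed.

Lemma cvg_sum (R : realType) (T : Type) (F : set_system T) (W : normedModType R)
    (n : nat) (f : 'I_n -> T -> W) (l : 'I_n -> W) : Filter F ->
  (forall i, f i @ F --> l i) -> (fun x => \sum_i f i x) @ F --> \sum_i l i.
Proof.
move=> FF fl.
suff H (s : seq 'I_n) : (fun x => \sum_(i <- s) f i x) @ F --> \sum_(i <- s) l i.
  exact: H.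
elim: s => [|i s IH].
  by rewrite big_nil; under eq_cvg do rewrite big_nil; exact: cvg_cst.
by rewrite big_cons; under eq_cvg do rewrite big_cons; exact: cvgD.
Qed.

Lemma is_derive_entry (R : realType) (m n : nat) (u : R -> 'M[R]_(m, n)) (t : R)
    (du : 'M[R]_(m, n))
    (i : 'I_m) (j : 'I_n) : is_derive t 1 u du -> is_derive t 1 (fun s => u s i j) (du i j).
Proof.
move=> [ud <-]; have /derivable_mxP/(_ i j) uij := ud.
by apply: DeriveDef => //; rewrite derive_mx// mxE.
Qed.

Lemma within_continuous_entry (R : realType) (m n : nat) (A : set R)
    (u : R -> 'M[R]_(m, n)) i j :
  {within A, continuous u} -> {within A, continuous (fun s => u s i j)}.
Proof. by move=> uc x; apply: continuous_comp (uc x) (@coord_continuous _ _ _ i j _). Qed.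

(** The bound on [dv] makes [v s * expR (- K * s)] nonincreasing and [v s * expR (K * s)]
    nondecreasing in [s]. The second conclusion runs backward in time. *)
Lemma gronwall_scalar (R : realType) (v dv : R -> R) (K a b : R) :
  a <= b -> {within `[a, b], continuous v} ->
  (forall t : R, t \in `]a, b[%R -> is_derive t 1 v (dv t)) ->
  (forall t : R, t \in `]a, b[%R -> `|dv t| <= K * v t) ->
  v b <= v a * expR (K * (b - a)) /\ v a <= v b * expR (K * (b - a)).
Proof.
move=> ab vc vd vK.
have Ed (c t : R) : is_derive t 1 (fun s => expR (c * s)) (c * expR (c * t)).
  by apply: is_derive_eq; rewrite /= /GRing.scale/= mulr1 mulrC.
have Ec (c : R) : continuous (fun s : R => expR (c * s)).
  by move=> t; apply/differentiable_continuous/derivable1_diffP; exact: ex_derive.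
have wE c : {within `[a, b], continuous (fun s => v s * expR (c * s))}.
  move=> t; apply: cvgM; first exact: vc.
  by apply: continuous_subspaceT; exact: Ec.
have dE c t : t \in `]a, b[%R ->
    is_derive t 1 (fun s => v s * expR (c * s)) ((dv t + c * v t) * expR (c * t)).
  move=> /vd vt; have Et := Ed c t.
  by apply: is_derive_eq; rewrite /= /GRing.scale/=; ring.
have aI : a \in `[a, b]%R by rewrite in_itv/= lexx ab.
have bI : b \in `[a, b]%R by rewrite in_itv/= lexx ab.
have split_exp x y : expR (K * (x - y)) = expR (K * x) * expR (- K * y).
  by rewrite -expRD; congr expR; ring.
split.
- have H : v b * expR (- K * b) <= v a * expR (- K * a).
    apply: (@ler0_derive1_le_cc _ (fun s => v s * expR (- K * s)) a b) => //.
    + by move=> t /(dE (- K))[].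
    + move=> t tab; rewrite derive1E; have := vK _ tab; have [_ ->] := dE (- K) _ tab.
      rewrite ler_norml => /andP[_ H]; rewrite pmulr_lle0 ?expR_gt0//; lra.
  rewrite split_exp mulrCA mulrC -ler_pdivrMr ?expR_gt0// -expRN.
  by rewrite -mulNr.
- have H : v a * expR (K * a) <= v b * expR (K * b).
    apply: (@ger0_derive1_le_cc _ (fun s => v s * expR (K * s)) a b) => //.
    + by move=> t /(dE K)[].
    + move=> t tab; rewrite derive1E; have := vK _ tab; have [_ ->] := dE K _ tab.
      rewrite ler_norml => /andP[H _]; rewrite pmulr_lge0 ?expR_gt0//; lra.
  rewrite split_exp mulrA -ler_pdivrMr ?expR_gt0// -expRN.
  by rewrite mulNr opprK.
Qed.

(** [C] is chosen before [u], [eps] and the interval, so that one constant serves a whole family of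
    difference quotients. *)
Lemma gronwall (R : realType) (m : nat) (L T : R) : 0 <= L -> 0 <= T ->
  exists2 C : R, 0 < C & forall (u du : R -> 'cV[R]_m) (eps a b : R),
    0 <= eps -> a <= b -> b - a <= T -> {within `[a, b], continuous u} ->
    (forall t : R, t \in `]a, b[%R -> is_derive t 1 u (du t)) ->
    (forall t : R, t \in `]a, b[%R -> `|du t| <= L * `|u t| + eps) ->
    `|u b| <= C * (`|u a| + eps) /\ `|u a| <= C * (`|u b| + eps).
Proof.
(* [2 * m] comes from differentiating [m] squares; [L + 1] from [L * x ^+ 2 + x * eps <= (L + 1) *
   (x ^+ 2 + eps ^+ 2)], with [x] the norm of [u t]. *)
move=> L0 T0; pose K := 2 * m%:R * (L + 1).
have K0 : 0 <= K by rewrite /K !mulr_ge0// addr_ge0.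
(* [m + 1] comes from bounding [m * x ^+ 2 + eps ^+ 2] by a multiple of [(x + eps) ^+ 2]. As
   [C >= 1], [C <= C ^+ 2], and the bound on squared norms passes to norms without a square root of
   [C]. *)
pose C := (m%:R + 1) * expR (K * T).
have C1 : 1 <= C.
  rewrite /C -[1]mulr1 ler_pM//; first by rewrite mulr1 lerDr.
  by rewrite -expR0 ler_expR mulr_ge0.
exists C => [|u du eps a b eps0 ab bT uc ud uL]; first exact: lt_le_trans C1.
(* Adding [eps ^+ 2] absorbs the inhomogeneous term, so [v] satisfies a homogeneous differential
   inequality. *)
pose v s := \sum_i u s i 0 ^+ 2 + eps ^+ 2.
pose dv s := \sum_i 2 * u s i 0 * du s i 0.
have vc : {within `[a, b], continuous v}.
  apply/subspace_continuousP => t tab; apply: cvgD; last exact: cvg_cst.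
  apply: cvg_sum => i.
  have /subspace_continuousP/(_ t tab) uit :
      {within `[a, b], continuous (fun s => u s i 0)}.
    exact: within_continuous_entry uc.
  by rewrite expr2; apply: (cvg_trans _ (cvgM uit uit)).
have vd t : t \in `]a, b[%R -> is_derive t 1 v (dv t).
  move=> tab.
  have H (i : 'I_m) : is_derive t 1 (fun s => u s i 0 ^+ 2) (2 * u t i 0 * du t i 0).
    have H := is_derive_entry i 0 (ud t tab).
    by apply: is_derive_eq; rewrite /= /GRing.scale/=; ring.
  have -> : v = (\sum_(i < m) (fun s => u s i 0 ^+ 2)) + cst (eps ^+ 2).
    by apply/funext => s; rewrite /v /= !fctE fct_sumE.
  by apply: is_derive_eq; rewrite addr0.
have vK t : t \in `]a, b[%R -> `|dv t| <= K * v t.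
  move=> tab; have H := uL t tab.
  have /andP[S1 S2] := cV_norm_sqr_bounds (u t).
  have u0 : 0 <= `|u t| by [].
  have m0 : 0 <= m%:R :> R by [].
  apply: le_trans (_ : \sum_(i < m) 2 * (`|u t| * (L * `|u t| + eps)) <= _).
    apply: le_trans (ler_norm_sum _ _ _) _.
    apply: ler_sum => i _.
    rewrite !normrM ger0_norm// -mulrA ler_pM2l//; apply: ler_pM => //.
      exact: mx_norm_entry.
    by apply: le_trans H; exact: mx_norm_entry.
  have P : 2 * (`|u t| * (L * `|u t| + eps)) <= 2 * (L + 1) * v t.
    rewrite /v; set S := \sum_i _ in S1 S2 *; set x := `|u t| in S1 S2 u0 *.
    have : L * x ^+ 2 <= L * S by rewrite ler_wpM2l.
    have : x * eps <= x ^+ 2 + eps ^+ 2.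
      have := sqr_ge0 (x - eps); have := sqr_ge0 (x + eps); nra.
    have : 0 <= L * eps ^+ 2 by rewrite mulr_ge0 ?sqr_ge0.
    lra.
  rewrite sumr_const card_ord -[_ *+ m]mulr_natl.
  apply: le_trans (ler_wpM2l m0 P) _; rewrite /K; lra.
have [v1 v2] := gronwall_scalar ab vc vd vK.
have expT : expR (K * (b - a)) <= expR (K * T) by rewrite ler_expR ler_wpM2l.
have fin (x y : 'cV[R]_m) : `|y| ^+ 2 <=
    (\sum_i x i 0 ^+ 2 + eps ^+ 2) * expR (K * (b - a)) ->
    `|y| <= C * (`|x| + eps).
  move=> H; have /andP[_ S2] := cV_norm_sqr_bounds x.
  have C0 : 0 <= C by apply: le_trans C1.
  rewrite -(@ler_pXn2r _ 2) ?nnegrE// ?mulr_ge0 ?addr_ge0//.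
  apply: le_trans H _.
  have S0 : 0 <= \sum_i x i 0 ^+ 2 by apply: sumr_ge0 => i _; exact: sqr_ge0.
  apply: le_trans (_ : C * (`|x| + eps) ^+ 2 <= _); last first.
    by rewrite exprMn ler_wpM2r ?sqr_ge0// ler_eXnr.
  rewrite /C [leRHS]mulrAC; apply: ler_pM => //; first by rewrite addr_ge0 ?sqr_ge0.
  have x0 : 0 <= `|x| by [].
  have m0 : 0 <= m%:R :> R by [].
  have := mulr_ge0 m0 (sqr_ge0 eps).
  have := mulr_ge0 m0 (mulr_ge0 x0 eps0).
  have := mulr_ge0 x0 eps0; have := sqr_ge0 `|x|; nra.
have vge s : `|u s| ^+ 2 <= v s.
  have /andP[S1 _] := cV_norm_sqr_bounds (u s); have := sqr_ge0 eps; rewrite /v; lra.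
by split; apply: fin; [apply: le_trans v1|apply: le_trans v2].
Qed.

(** * Derivatives and uniform limits along an interval *)

Lemma subitv_cc (R : realType) (a b s r : R) :
  s \in `[a, b]%R -> r \in `[a, b]%R -> `[s, r] `<=` `[a, b].
Proof.
rewrite !in_itv/= => /andP[as_ _] /andP[_ rb] z /=; rewrite !in_itv/= => /andP[sz zr].
by rewrite (le_trans as_ sz) (le_trans zr rb).
Qed.

Lemma subitv_oo (R : realType) (a b s r z : R) :
  s \in `[a, b]%R -> r \in `[a, b]%R -> z \in `]s, r[%R -> z \in `]a, b[%R.
Proof.
rewrite !in_itv/= => /andP[as_ _] /andP[_ rb] /andP[sz zr].
by rewrite (le_lt_trans as_ sz) (lt_le_trans zr rb).
Qed.

Lemma subitv_oo_cc (R : realType) (a b z : R) : z \in `]a, b[%R -> z \in `[a, b]%R.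
Proof. by rewrite !in_itv/= => /andP[/ltW-> /ltW->]. Qed.

Lemma within_continuous_dist (R : realType) (W : normedModType R) (u : R -> W)
    (i : interval R) :
  {within [set` i], continuous u} <-> forall t : R, t \in i -> forall e : R, 0 < e ->
    exists2 d : R, 0 < d & forall s : R, s \in i -> `|s - t| < d -> `|u s - u t| < e.
Proof.
split.
  move=> /subspace_continuousP uc t ti e e0.
  have /cvgrPdist_lt/(_ e e0) := uc t ti.
  rewrite near_withinE => /nbhs_ballP[d /= d0 H]; exists d => // s si sd.
  by rewrite distrC; apply: H => //; rewrite -ball_normE/= distrC.
move=> H; apply/subspace_continuousP => t ti; apply/cvgrPdist_lt => e e0.
have [d d0 {}H] := H t ti e e0.
rewrite near_withinE; apply/nbhs_ballP; exists d => // s; rewrite -ball_normE/= => sd si.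
by rewrite distrC; apply: H => //; rewrite distrC.
Qed.

(** Multiplied out by [h], the condition also covers [h = 0], and differentiation becomes an
    inequality that explicit estimates can feed. *)
Lemma is_deriveP (R : realType) (V W : normedModType R) (f : V -> W) (x v : V)
    (l : W) :
  is_derive x v f l <-> forall e : R, 0 < e -> exists2 d : R, 0 < d &
    forall h : R, `|h| < d -> `|f (h *: v + x) - f x - h *: l| <= e * `|h|.
Proof.
have E (h : R) : h != 0 -> `|l - h^-1 *: (f (h *: v + x) - f x)| =
    `|f (h *: v + x) - f x - h *: l| / `|h|.
  move=> h0; rewrite [RHS]mulrC -normfV -normrZ [in RHS]scalerBr scalerA mulVf//.
  by rewrite scale1r distrC.
split.
  move=> [/cvg_ex[l' fl] lE] e e0.
  have El : l' = l by rewrite -lE; apply/esym/cvg_lim.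
  move/cvgrPdist_le : fl => /(_ e e0); rewrite El => /nbhs_ballP[d /= d0 H].
  exists d => // h hd.
  have [->|h0] := eqVneq h 0.
    by rewrite !scale0r add0r subrr subr0 !normr0 mulr0.
  rewrite -ler_pdivrMr ?normr_gt0// -E//; apply: H => //=.
  by rewrite -ball_normE/= sub0r normrN.
move=> H.
have fl : (fun h => h^-1 *: ((f \o shift x) (h *: v) - f x)) @ 0^' --> l.
  apply/cvgrPdist_le => e e0; have [d d0 {}H] := H e e0.
  apply/nbhs_ballP; exists d => //= h; rewrite -ball_normE/= sub0r normrN => hd h0.
  by rewrite E// ler_pdivrMr ?normr_gt0//; exact: H.
by split; [apply/cvg_ex; exists l|exact: cvg_lim].
Qed.

(** For the sup norm, the scalar mean value theorem on each entry, with its own intermediate point,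
    loses no constant. Subtracting [c] measures the deviation from an affine motion. *)
Lemma mean_value_norm (R : realType) (m n : nat) (u du : R -> 'M[R]_(m, n))
    (c : 'M[R]_(m, n)) (a b K : R) :
  a <= b -> 0 <= K -> {within `[a, b], continuous u} ->
  (forall t : R, t \in `]a, b[%R -> is_derive t 1 u (du t)) ->
  (forall t : R, t \in `]a, b[%R -> `|du t - c| <= K) ->
  `|u b - u a - (b - a) *: c| <= K * (b - a).
Proof.
move=> ab K0 uc ud uK; apply/mx_norm_le; first by rewrite mulr_ge0// subr_ge0.
move=> i j; have [<-|/negPf anb] := eqVneq a b.
  by rewrite !mxE !subrr mul0r subrr normr0 mulr0.
have {}ab : a < b by rewrite lt_neqAle anb ab.
have [s sab E] := MVT ab (fun t tab => is_derive_entry i j (ud t tab))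
  (within_continuous_entry (i := i) (j := j) uc).
rewrite !mxE E -[(b - a) * _]mulrC -mulrBl normrM [`|b - a|]gtr0_norm ?subr_gt0//.
rewrite ler_wpM2r ?subr_ge0 ?(ltW ab)//; apply: le_trans (uK s sab).
by have := mx_norm_entry (du s - c) i j; rewrite !mxE.
Qed.

Lemma uniform_limit_continuous (R : realType) (W : normedModType R)
    (i : interval R) (y : R -> W) :
  (forall e : R, 0 < e -> exists2 q : R -> W, {within [set` i], continuous q} &
    forall t : R, t \in i -> `|q t - y t| <= e) ->
  {within [set` i], continuous y}.
Proof.
move=> H; apply/within_continuous_dist => t ti e e0.
have e4 : 0 < e / 4 by rewrite divr_gt0.
have [q /within_continuous_dist qc qy] := H _ e4.
have [d d0 qd] := qc t ti _ e4; exists d => // s si std.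
have -> : y s - y t = (q s - q t) - (q s - y s) + (q t - y t).
  by rewrite opprB [q s - q t + _]addrC subrKA subrKA.
have := ler_normD ((q s - q t) - (q s - y s)) (q t - y t).
have := ler_normB (q s - q t) (q s - y s).
have := qy t ti; have := qy s si; have := qd s si std; lra.
Qed.

(** The mean value inequality is applied to the approximations [q], since [y] is not yet known to be
    differentiable; continuity of [dy] keeps [dq] close to [dy t0] near [t0]. *)
Lemma uniform_limit_derive (R : realType) (m : nat) (a b : R)
    (y dy : R -> 'cV[R]_m) (t0 : R) :
  (forall e : R, 0 < e -> exists q dq : R -> 'cV[R]_m,
    [/\ {within `[a, b], continuous q},
      (forall t : R, t \in `[a, b]%R -> `|q t - y t| <= e),
      (forall t : R, t \in `]a, b[%R -> is_derive t 1 q (dq t)) &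
      (forall t : R, t \in `]a, b[%R -> `|dq t - dy t| <= e)]) ->
  {within `[a, b], continuous dy} ->
  t0 \in `]a, b[%R -> is_derive t0 1 y (dy t0).
Proof.
move=> H /within_continuous_dist dyc t0ab; apply/is_deriveP => e e0.
have [at0 t0b] : a < t0 /\ t0 < b by move: t0ab; rewrite in_itv/= => /andP[].
have t0cc : t0 \in `[a, b]%R by rewrite in_itv/= !ltW.
have [d1 d10 dyd] := dyc t0 t0cc e e0.
exists (Num.min d1 (Num.min (t0 - a) (b - t0))).
  by rewrite !lt_min d10 !subr_gt0 at0 t0b.
move=> h; rewrite !lt_min => /and3P[hd ha hb].
have h0 : 0 <= `|h| by [].
have scaleR1 (z : R) : z *: (1 : R^o) = z by rewrite /GRing.scale/= mulr1.
rewrite [h *: _]scaleR1.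
have [hl hu] : - `|h| <= h /\ h <= `|h| by move: (lexx `|h|); rewrite ler_norml => /andP[].
apply/ler_addgt0Pr => g g0.
(* The mean value inequality loses [eta] times the length of [h], and replacing [q] by [y] loses
   [eta] at each of two endpoints; the total is the arbitrary [g]. *)
pose eta := g / (2 + `|h|).
have eta0 : 0 < eta by rewrite divr_gt0// ltr_wpDr.
have Eg : eta * (2 + `|h|) = g by rewrite divfK// gt_eqF// ltr_wpDr.
have [q [dq [qc qy qd qdy]]] := H _ eta0.
have qinc (s r : R) : s <= r -> s \in `[a, b]%R -> r \in `[a, b]%R ->
    `|s - t0| <= `|h| -> `|r - t0| <= `|h| ->
    `|q r - q s - (r - s) *: dy t0| <= (eta + e) * (r - s).
  move=> sr sab rab; rewrite !ler_norml => /andP[s1 _] /andP[_ r2].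
  have K0 : 0 <= eta + e by rewrite addr_ge0// ltW.
  have dqK z : z \in `]s, r[ -> `|dq z - dy t0| <= eta + e.
    move=> zsr; have zab := subitv_oo sab rab zsr.
    have zt : `|z - t0| < d1.
      apply: le_lt_trans hd; rewrite ler_norml; move: zsr; rewrite in_itv/= => /andP[sz zr].
      apply/andP; split; first by apply: le_trans s1 _; rewrite lerB// ltW.
      by apply: le_trans r2; rewrite lerB// ltW.
    rewrite -(subrKA (dy z)); apply: le_trans (ler_normD _ _) _.
    by apply: lerD; [exact: qdy|apply: ltW; apply: dyd => //; exact: subitv_oo_cc].
  exact: (mean_value_norm sr K0 (continuous_subspaceW (subitv_cc sab rab) qc)
    (fun z zsr => qd z (subitv_oo sab rab zsr)) dqK).
have hcc : h + t0 \in `[a, b]%R.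
  clear -ha hb hl hu; rewrite in_itv/=; apply/andP; split; lra.
have qb : `|q (h + t0) - q t0 - h *: dy t0| <= (eta + e) * `|h|.
  have [h00|h00] := leP 0 h.
    have := qinc t0 (h + t0); rewrite addrK subrr normr0 [in X in _ -> _ <= X](ger0_norm h00).
    by apply => //; rewrite ?lerDr.
  have -> : q (h + t0) - q t0 - h *: dy t0 =
      - (q t0 - q (h + t0) - (t0 - (h + t0)) *: dy t0).
    by apply/matrixP => i j; rewrite !mxE; ring.
  have -> : `|h| = t0 - (h + t0) by rewrite ltr0_norm// opprD addrCA subrr addr0.
  rewrite normrN; apply: qinc => //; first by rewrite gerDr ltW.
    by rewrite addrK.
  by rewrite subrr normr0.
have -> : y (h + t0) - y t0 - h *: dy t0 =
    (q (h + t0) - q t0 - h *: dy t0) - (q (h + t0) - y (h + t0)) + (q t0 - y t0).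
  by apply/matrixP => i j; rewrite !mxE; ring.
apply: le_trans (ler_normD _ _) _; have := qy _ t0cc; have := qy _ hcc.
have := ler_normB (q (h + t0) - q t0 - h *: dy t0) (q (h + t0) - y (h + t0)).
move: (`|_ - _ - _ - _|) (`|q t0 - y t0|) (`|q (h + t0) - y (h + t0)|) => x1 x2 x3.
move: qb Eg; move: (`|_ - _ - _|) => x4; clear; lra.
Qed.

(* The set of times where [u] leaves the ball of radius [d] is closed, so if it
   were nonempty Gronwall's bound up to its infimum would contradict the
   definition of the infimum. *)
Lemma gronwall_bootstrap (R : realType) (m : nat) (L T : R) : 0 <= L -> 0 <= T ->
  exists2 C : R, 0 < C & forall (u du : R -> 'cV[R]_m) (d : R),
    {within `[0, T], continuous u} ->
    (forall t : R, t \in `]0, T[%R -> is_derive t 1 u (du t)) ->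
    (forall t : R, t \in `]0, T[%R -> `|u t| < d -> `|du t| <= L * `|u t|) ->
    C * `|u 0| < d -> forall t : R, t \in `[0, T]%R -> `|u t| <= C * `|u 0|.
Proof.
move=> L0 T0; have [C C0 G] := gronwall m L0 T0.
exists C => // u du d uc ud uL Cd.
have G0 s : s \in `[0, T]%R -> (forall r, r \in `]0, s[%R -> `|u r| < d) ->
    `|u s| <= C * `|u 0|.
  move=> sT us; have := sT; rewrite in_itv/= => /andP[s0 sT'].
  have T0' : 0 \in `[0, T]%R by rewrite in_itv/= lexx.
  have s0T : s - 0 <= T by rewrite subr0.
  have uL0 z : z \in `]0, s[%R -> `|du z| <= L * `|u z| + 0.
    by move=> zs; rewrite addr0; apply: uL; [exact: subitv_oo zs|exact: us].
  have [+ _] := G u du 0 0 s (lexx 0) s0 s0T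
    (continuous_subspaceW (subitv_cc T0' sT) uc)
    (fun z zs => ud z (subitv_oo T0' sT zs)) uL0.
  by rewrite addr0.
suff ud_lt s : s \in `[0, T]%R -> `|u s| < d.
  move=> t tT; apply: G0 => // r rt; apply: ud_lt; apply: subitv_oo_cc.
  by apply: subitv_oo rt; rewrite // in_itv/= lexx.
move=> sT; rewrite ltNge; apply/negP => sd.
pose B := [set r | r \in `[0, T]%R /\ d <= `|u r|].
have Bs : B s by [].
have B0 : lbound B 0 by move=> r [+ _]; rewrite in_itv/= => /andP[].
have hB : has_inf B by split; [exists s|exists 0].
have rT : inf B \in `[0, T]%R.
  move: sT; rewrite !in_itv/= => /andP[_ sT]; apply/andP; split.
    by apply: lb_le_inf => //; exists s.
  by apply: le_trans sT; apply: ge_inf => //; exists 0.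
(* [B] has no point before its infimum, and [G0] only asks for control on an open interval, so the
   bound reaches [inf B] itself. *)
have H : `|u (inf B)| < d.
  apply: le_lt_trans Cd; apply: G0 => // r rB; rewrite ltNge; apply/negP => dr.
  have : inf B <= r.
    apply: ge_inf; first by exists 0.
    split=> //; apply: subitv_oo_cc; apply: subitv_oo rB => //.
    by rewrite in_itv/= lexx.
  by move: rB; rewrite in_itv/= => /andP[_]; rewrite ltNge => /negP.
have /within_continuous_dist/(_ _ rT (d - `|u (inf B)|)) := uc.
rewrite subr_gt0 => /(_ H)[e e0 ue].
have [r Br rlt] := inf_adherent e0 hB; have [rT' dr] := Br.
have ri : inf B <= r by apply: ge_inf => //; exists 0.
have /(ue _ rT') : `|r - inf B| < e by rewrite ger0_norm ?subr_ge0// ltrBlDl.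
have := lerB_dist (u r) (u (inf B)); clear -dr; lra.
Qed.

(** * Uniform estimates along a path *)

Lemma path_continuous (R : realType) (E W : normedModType R) (Om : set (R * E))
    (g : R * E -> W) (h : R -> E) (i : interval R) :
  (forall p, Om p -> {for p, continuous g}) ->
  {within [set` i], continuous h} -> (forall t : R, t \in i -> Om (t, h t)) ->
  {within [set` i], continuous (fun t => g (t, h t))}.
Proof.
move=> gc /subspace_continuousP hc hO; apply/subspace_continuousP => t ti.
have H : (fun s => (s, h s)) @ within [set` i] (nbhs t) --> (t, h t).
  exact: (cvg_pair (@cvg_within R (nbhs t) _ [set` i]) (hc t ti)).
exact: (cvg_comp _ _ H (gc _ (hO t ti))).
Qed.

Lemma path_bounded (R : realType) (E W : normedModType R) (Om : set (R * E))
    (g : R * E -> W) (h : R -> E) (a b : R) :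
  (forall p, Om p -> {for p, continuous g}) ->
  {within `[a, b], continuous h} -> (forall t : R, t \in `[a, b]%R -> Om (t, h t)) ->
  exists2 M : R, 0 <= M & forall t : R, t \in `[a, b]%R -> `|g (t, h t)| <= M.
Proof.
move=> gc hc hO; have [ab|ba] := leP a b; last first.
  exists 0 => // t; rewrite in_itv/= => /andP[at_ tb].
  by have := le_trans at_ tb; rewrite leNgt ba.
have /within_continuous_dist pc := path_continuous gc hc hO.
have nc : {within `[a, b], continuous (fun t => `|g (t, h t)|)}.
  apply/within_continuous_dist => t ti e e0; have [d d0 H] := pc t ti e e0.
  by exists d => // s si sd; apply: le_lt_trans (ler_dist_dist _ _) (H s si sd).
have [c _ cM] := EVT_max ab nc.
by exists `|g (c, h c)|.
Qed.

(** Each time has its own neighbourhood and radius; compactness of the segment extracts a common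
    [d]. Stating the result for all small [d] lets finitely many tubes be intersected. *)
Lemma path_tube (R : realType) (E W : normedModType R) (Om : set (R * E))
    (g : R * E -> W) (h : R -> E) (a b e : R) :
  open Om -> (forall p, Om p -> {for p, continuous g}) ->
  {within `[a, b], continuous h} -> (forall t : R, t \in `[a, b]%R -> Om (t, h t)) ->
  0 < e -> \forall d \near 0^'+, forall t : R, t \in `[a, b]%R ->
    forall w : E, `|w - h t| < d -> Om (t, w) /\ `|g (t, w) - g (t, h t)| < e.
Proof.
move=> Oo gc /within_continuous_dist hc hO e0.
have /compact_near_coveringP/near_covering_withinP cov := @segment_compact R a b.
pose P (d t : R) := forall w : E, `|w - h t| < d ->
  Om (t, w) /\ `|g (t, w) - g (t, h t)| < e.
apply: (cov _ _ P) => t0 t0ab.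
have e2 : 0 < e / 2 by rewrite divr_gt0.
have O0 := hO t0 t0ab.
have : \forall p \near (t0, h t0), Om p /\ `|g (t0, h t0) - g p| < e / 2.
  near=> p; split; near: p; first exact: open_nbhs_nbhs.
  by have /cvgrPdist_lt/(_ _ e2) := gc _ O0.
move=> /nbhs_ballP[r /= r0 H].
have r2 : 0 < r / 2 by rewrite divr_gt0.
have [d d0 hd] := hc t0 t0ab _ r2.
(* The first factor keeps [t] near [t0] and [h t] within [r / 2] of [h t0]; with [k < r / 2], any
   [w] within [k] of [h t] then lies within [r] of [h t0]. *)
exists ([set t | `|t - t0| < Num.min d r], [set k : R | k < r / 2]) => /=.
  split; last exact: nbhs_right_lt.
  apply/nbhs_ballP; exists (Num.min d r) => /=; first by rewrite lt_min d0.
  by move=> t; rewrite -ball_normE/= distrC.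
move=> [t k] /= []; rewrite lt_min => /andP[td tr] kr tab w wk.
have htb := hd t tab td.
have B x : `|x - h t0| < r -> Om (t, x) /\ `|g (t0, h t0) - g (t, x)| < e / 2.
  move=> xr; apply: H; split; rewrite -ball_normE/=; first by rewrite distrC.
  by rewrite distrC.
have [|Ow gw] := B w.
  rewrite -(subrKA (h t)); apply: le_lt_trans (ler_normD _ _) _.
  by rewrite [r]splitr ltrD// (lt_trans wk).
have [|_ gh] := B (h t).
  by apply: lt_trans htb _; rewrite ltr_pdivrMr// ltr_pMr// ltr1n.
split=> //; rewrite -(subrKA (g (t0, h t0))); apply: le_lt_trans (ler_normD _ _) _.
by rewrite [e]splitr ltrD// distrC.
Unshelve. all: by end_near. Qed.

(** * Linearisation of the field in the space variable *)

Lemma is_derive_line (R : realType) (V W : normedModType R) (f : V -> W)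
    (x v : V) (c s : R) (l : W) :
  is_derive (x + (s * c) *: v) v f l ->
  is_derive s 1 (fun r => f (x + (r * c) *: v)) (c *: l).
Proof.
move=> /is_deriveP H; apply/is_deriveP => e e0.
have c1 : 0 < `|c| + 1 by rewrite ltr_wpDl.
have [d d0 {}H] := H (e / (`|c| + 1)) (divr_gt0 e0 c1).
exists (d / (`|c| + 1)); first by rewrite divr_gt0.
move=> h hd; have hc : `|h * c| < d.
  rewrite normrM; apply: le_lt_trans (_ : `|h| * (`|c| + 1) < d).
    by rewrite ler_wpM2l// lerDl.
  by rewrite -ltr_pdivlMr.
have {}H := H _ hc.
have -> : x + ((h *: (1 : R^o) + s) * c) *: v = (h * c) *: v + (x + (s * c) *: v).
  by rewrite [h *: _]mulr1 mulrDl scalerDl addrCA.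
rewrite scalerA; apply: le_trans H _.
rewrite normrM mulrAC ler_pdivrMr// -mulrA ler_wpM2l ?(ltW e0)//.
by rewrite ler_wpM2l// lerDl.
Qed.

(** Convertible with the family inside [C0k], so the regularity hypothesis speaks of these
    directions directly. *)
Definition space_dir (R : realType) (m : nat) (i : 'I_m) : R * 'cV[R]_m :=
  (0, basis_vec R i).

(** The Jacobian of [f] in the space variable, applied to [v]. [C0k] provides partial derivatives,
    hence the sum; [space_diff_increment] shows that it approximates increments of [f]. *)
Definition space_diff (R : realType) (m : nat) (W : normedModType R)
    (f : R * 'cV[R]_m -> W) (p : R * 'cV[R]_m) (v : 'cV[R]_m) : W :=
  \sum_i v i 0 *: 'D_(space_dir R i) f p.

Lemma space_diffB (R : realType) (m : nat) (W : normedModType R)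
    (f : R * 'cV[R]_m -> W) (p : R * 'cV[R]_m) (v w : 'cV[R]_m) :
  space_diff f p (v - w) = space_diff f p v - space_diff f p w.
Proof.
rewrite /space_diff -sumrB; apply: eq_bigr => i _.
by rewrite !mxE scalerBl.
Qed.

Lemma space_diffZ (R : realType) (m : nat) (W : normedModType R)
    (f : R * 'cV[R]_m -> W) (p : R * 'cV[R]_m) (c : R) (v : 'cV[R]_m) :
  space_diff f p (c *: v) = c *: space_diff f p v.
Proof.
rewrite /space_diff scaler_sumr; apply: eq_bigr => i _.
by rewrite !mxE scalerA.
Qed.

(* The increment from [z] to [w] is split along the coordinate axes; the
   intermediate points stay in the ball because the norm is the sup norm. *)
Lemma space_diff_increment (R : realType) (m p : nat)
    (f : R * 'cV[R]_m -> 'cV[R]_p) (t d e : R) (z w : 'cV[R]_m) :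
  0 <= e -> `|w - z| < d ->
  (forall w' : 'cV[R]_m, `|w' - z| < d -> forall i,
    derivable f (t, w') (space_dir R i) /\
    `|'D_(space_dir R i) f (t, w') - 'D_(space_dir R i) f (t, z)| <= e) ->
  `|f (t, w) - f (t, z) - space_diff f (t, z) (w - z)| <= m%:R * e * `|w - z|.
Proof.
move=> e0 wzd H.
pose W (j : nat) : 'cV[R]_m := \col_i (if (i < j)%N then w i 0 else z i 0).
have -> : f (t, w) - f (t, z) = \sum_(j < m) (f (t, W j.+1) - f (t, W j)).
  rewrite -(big_mkord predT (fun j => f (t, W j.+1) - f (t, W j))) telescope_sumr//.
  by congr (f (_, _) - f (_, _)); apply/matrixP => i j; rewrite !mxE (ord1 j)// ltn_ord.
rewrite /space_diff -sumrB; apply: le_trans (ler_norm_sum _ _ _) _.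
apply: le_trans (_ : \sum_(j < m) e * `|w - z| <= _); last first.
  by rewrite sumr_const card_ord -[_ *+ m]mulr_natl mulrA.
apply: ler_sum => j _; set c : R := (w - z) j 0.
have cE : `|c| <= `|w - z| by exact: mx_norm_entry.
pose x : R * 'cV[R]_m := (t, W j).
have xE (s : R) : x + (s * c) *: space_dir R j = (t, W j + (s * c) *: basis_vec R j).
  transitivity (t + (s * c) * 0, W j + (s * c) *: basis_vec R j) => //.
  by rewrite mulr0 addr0.
have inball (s : R) : 0 <= s -> s <= 1 -> `|W j + (s * c) *: basis_vec R j - z| < d.
  move=> s0 s1; apply: le_lt_trans wzd; apply/mx_norm_le => // i k.
  rewrite (ord1 k) /basis_vec !mxE eqxx andbT.
  have wzi := mx_norm_entry (w - z) i 0; rewrite !mxE in wzi.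
  have [ij|ij] := eqVneq i j.
    rewrite ij ltnn mulr1 addrAC subrr add0r normrM ger0_norm//.
    by apply: le_trans cE; rewrite ler_piMl.
  by rewrite mulr0 addr0; case: ifP => // _; rewrite subrr normr0.
have phid (s : R) : s \in `[0, 1]%R ->
    is_derive s 1 (fun r => f (x + (r * c) *: space_dir R j))
    (c *: 'D_(space_dir R j) f (x + (s * c) *: space_dir R j)).
  rewrite in_itv/= => /andP[s0 s1]; apply: is_derive_line; apply: derivableP.
  by rewrite xE; have [] := H _ (inball s s0 s1) j.
have end1 : f (x + c *: space_dir R j) = f (t, W j.+1).
  have := xE 1; rewrite mul1r => ->; congr (f (_, _)).
  apply/matrixP => i k; rewrite (ord1 k) /basis_vec !mxE eqxx andbT.
  rewrite [in RHS]ltnS [in RHS]leq_eqVlt.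
  have [ij|ij] := eqVneq i j.
    by rewrite ij eqxx ltnn/= mulr1 /c !mxE addrC subrK.
  have -> : (nat_of_ord i == nat_of_ord j) = false.
    by apply/eqP => /val_inj /eqP; rewrite (negPf ij).
  by rewrite /= mulr0 addr0.
have phic : {within `[0, 1], continuous (fun r => f (x + (r * c) *: space_dir R j))}.
  by apply: derivable_within_continuous => s /phid[].
have phiK (s : R) : s \in `]0, 1[%R ->
    `|c *: 'D_(space_dir R j) f (x + (s * c) *: space_dir R j) -
      c *: 'D_(space_dir R j) f (t, z)| <= e * `|w - z|.
  rewrite in_itv/= => /andP[/ltW s0 /ltW s1].
  rewrite -scalerBr normrZ mulrC xE; have [_ H1] := H _ (inball s s0 s1) j.
  exact: ler_pM.
have := mean_value_norm ler01 (mulr_ge0 e0 (normr_ge0 (w - z))) phic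
  (fun s s01 => phid s (subitv_oo_cc s01)) phiK.
by rewrite mul0r scale0r addr0 mul1r subr0 mulr1 scale1r end1.
Qed.

(** Turns regularity of [f] into the estimates used from here on: a bound for the Jacobian on the
    path and, in a tube whose radius is uniform in time by compactness, the linearisation error and
    the oscillation of the Jacobian. *)
Lemma C0k1_along_path (R : realType) (m : nat) (Om : set (R * 'cV[R]_m))
    (f : R * 'cV[R]_m -> 'cV[R]_m) (h : R -> 'cV[R]_m) (a b : R) :
  open Om -> C0k 1 Om f -> {within `[a, b], continuous h} ->
  (forall t : R, t \in `[a, b]%R -> Om (t, h t)) ->
  (exists2 L : R, 0 <= L & forall t : R, t \in `[a, b]%R ->
     forall v : 'cV[R]_m, `|space_diff f (t, h t) v| <= L * `|v|) /\
  forall e : R, 0 < e -> exists2 d : R, 0 < d & forall t : R, t \in `[a, b]%R ->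
    forall w : 'cV[R]_m, `|w - h t| < d ->
    [/\ Om (t, w),
        `|f (t, w) - f (t, h t) - space_diff f (t, h t) (w - h t)| <=
          e * `|w - h t| &
        forall v : 'cV[R]_m,
          `|space_diff f (t, w) v - space_diff f (t, h t) v| <= e * `|v|].
Proof.
move=> Oo [fc fd] hc hO.
have Dc i p : Om p -> {for p, continuous (fun q => 'D_(space_dir R i) f q)}.
  by have [_ [+ _]] := fd i; exact.
split.
  have /choice[M HM] : forall i : 'I_m, exists M : R, 0 <= M /\
      forall t : R, t \in `[a, b]%R -> `|'D_(space_dir R i) f (t, h t)| <= M.
    by move=> i; have [M M0 HM] := path_bounded (Dc i) hc hO; exists M.
  exists (\sum_i M i); first by apply: sumr_ge0 => i _; have [] := HM i.
  move=> t tab v; rewrite mulr_suml; apply: le_trans (ler_norm_sum _ _ _) _.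
  apply: ler_sum => i _; rewrite normrZ mulrC ler_pM//; last exact: mx_norm_entry.
  by have [_] := HM i; apply.
(* Summing over coordinates costs a factor [m]; the [+ 1] covers [m = 0]. *)
move=> e e0; pose g := e / (m%:R + 1).
have m1 : 0 < m%:R + 1 :> R by rewrite ltr_wpDl.
have g0 : 0 < g by rewrite divr_gt0.
have mg : m%:R * g <= e.
  by rewrite /g mulrCA ger_pMr// ler_pdivrMr// mul1r lerDl.
have tube : \forall d \near 0^'+, forall i : 'I_m, forall t : R, t \in `[a, b]%R ->
    forall w : 'cV[R]_m, `|w - h t| < d -> Om (t, w) /\
      `|'D_(space_dir R i) f (t, w) - 'D_(space_dir R i) f (t, h t)| < g.
  by apply: filter_forall => i; exact: (path_tube Oo (Dc i) hc hO g0).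
have tube0 := path_tube Oo fc hc hO e0.
have : \forall d \near 0^'+, [/\ 0 < d, (forall i : 'I_m, forall t : R, t \in `[a, b]%R ->
    forall w : 'cV[R]_m, `|w - h t| < d -> Om (t, w) /\
      `|'D_(space_dir R i) f (t, w) - 'D_(space_dir R i) f (t, h t)| < g) &
    forall t : R, t \in `[a, b]%R ->
    forall w : 'cV[R]_m, `|w - h t| < d -> Om (t, w)].
  near=> d; split; first by near: d; exact: nbhs_right_gt.
    by near: d.
  move=> t tab w wd.
  by have [] := near tube0 d _ t tab w wd.
move=> /filter_ex[d [d0 Hd HO]]; exists d => // t tab w wd.
have Dw (w' : 'cV[R]_m) : `|w' - h t| < d -> forall i, derivable f (t, w') (space_dir R i) /\
    `|'D_(space_dir R i) f (t, w') - 'D_(space_dir R i) f (t, h t)| <= g.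
  move=> w'd i; have [Ow' /ltW] := Hd i t tab w' w'd; split=> //.
  by have [+ _] := fd i; apply.
split; first exact: HO.
  apply: le_trans (space_diff_increment (ltW g0) wd Dw) _.
  by rewrite ler_wpM2r.
move=> v; rewrite /space_diff -sumrB; apply: le_trans (ler_norm_sum _ _ _) _.
apply: le_trans (_ : \sum_(i < m) g * `|v| <= _).
  apply: ler_sum => i _; rewrite -scalerBr normrZ mulrC ler_pM//; last exact: mx_norm_entry.
  by have [] := Dw w wd i.
by rewrite sumr_const card_ord -[_ *+ m]mulr_natl mulrA ler_wpM2r.
Unshelve. all: by end_near. Qed.

(** * Dependence of the flow on its initial value, first order *)

(* No derivative is required at the endpoints: the solutions of the variational
   equation are only controlled on [0, T], so they have none there. *)
Definition solves_on (R : realType) (m : nat) (T : R)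
    (F : R -> 'cV[R]_m -> 'cV[R]_m) (u : R -> 'cV[R]_m) : Prop :=
  {within `[0, T], continuous u} /\
  forall t : R, t \in `]0, T[%R -> is_derive t 1 u (F t (u t)).

Lemma gronwall_itv (R : realType) (m : nat) (L T : R) : 0 <= L -> 0 <= T ->
  exists2 C : R, 0 < C & forall (u du : R -> 'cV[R]_m) (eps : R),
    0 <= eps -> {within `[0, T], continuous u} ->
    (forall t : R, t \in `]0, T[%R -> is_derive t 1 u (du t)) ->
    (forall t : R, t \in `]0, T[%R -> `|du t| <= L * `|u t| + eps) ->
    forall t : R, t \in `[0, T]%R ->
      `|u t| <= C * (`|u 0| + eps) /\ `|u 0| <= C * (`|u t| + eps).
Proof.
move=> L0 T0; have [C C0 G] := gronwall m L0 T0; exists C => //.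
move=> u du eps eps0 uc ud uL t tT.
have zT : 0 \in `[0, T]%R by rewrite in_itv/= lexx.
have [t0 tT'] : 0 <= t /\ t <= T by move: tT; rewrite in_itv/= => /andP[].
have t0T : t - 0 <= T by rewrite subr0.
exact: (G u du eps 0 t eps0 t0 t0T (continuous_subspaceW (subitv_cc zT tT) uc)
  (fun z zs => ud z (subitv_oo zT tT zs)) (fun z zs => uL z (subitv_oo zT tT zs))).
Qed.

Lemma within_continuousB (R : realType) (m : nat) (A : set R) (u v : R -> 'cV[R]_m) :
  {within A, continuous u} -> {within A, continuous v} ->
  {within A, continuous (fun t => u t - v t)}.
Proof.
move=> /subspace_continuousP uc /subspace_continuousP vc.
by apply/subspace_continuousP => t tA; apply: cvgB; [exact: uc|exact: vc].
Qed.

Lemma within_continuousZ (R : realType) (m : nat) (A : set R) (c : R) (u : R -> 'cV[R]_m) :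
  {within A, continuous u} -> {within A, continuous (fun t => c *: u t)}.
Proof.
move=> /subspace_continuousP uc.
by apply/subspace_continuousP => t tA; apply: cvgZr; exact: uc.
Qed.

Lemma dnbhs0_witness (R : realType) (P : set R) (r : R) :
  (\forall s \near 0^', P s) -> 0 < r -> exists s : R, [/\ P s, `|s| < r & s != 0].
Proof.
move=> HP r0; near (0 : R)^' => s; exists s; split; near: s => //.
  exact: dnbhs0_lt.
exact: nbhs_dnbhs_neq.
Unshelve. all: by end_near. Qed.

Section flow.
Variables (R : realType) (m : nat) (T : R) (Om : set (R * 'cV[R]_m)).
Variable f : R * 'cV[R]_m -> 'cV[R]_m.
Hypotheses (T0 : 0 <= T) (Oo : open Om) (fC1 : C0k 1 Om f).

Let sol (h : R -> 'cV[R]_m) := solves_on T (fun t v => f (t, v)) h /\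
  forall t : R, t \in `[0, T]%R -> Om (t, h t).


(** Inside the tube where [f] is linearised, the difference of two solutions satisfies a linear
    differential inequality; by the bootstrap it cannot leave the tube if it starts below
    [d / C]. *)
Lemma flow_stable (h0 : R -> 'cV[R]_m) : sol h0 ->
  exists C eta : R, [/\ 0 < C, 0 < eta & forall h, sol h -> `|h 0 - h0 0| < eta ->
    forall t : R, t \in `[0, T]%R -> `|h t - h0 t| <= C * `|h 0 - h0 0|].
Proof.
move=> [[h0c h0d] h0O].
have [[L L0 HL] Hinc] := C0k1_along_path Oo fC1 h0c h0O.
(* Linearisation with accuracy 1 is enough: it yields the Lipschitz constant [L + 1]. *)
have [d d0 Hd] := Hinc 1 ltr01.
have L10 : 0 <= L + 1 by rewrite addr_ge0.
have [C C0 G] := gronwall_bootstrap m L10 T0.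
exists C, (d / C); split=> //; first by rewrite divr_gt0.
move=> h [[hc hd] hO]; rewrite ltr_pdivlMr// mulrC => hd0.
pose u t := h t - h0 t; pose du t := f (t, h t) - f (t, h0 t).
have ud (t : R) : t \in `]0, T[%R -> is_derive t 1 u (du t).
  by move=> tT; exact: (is_deriveB (hd t tT) (h0d t tT)).
have uL (t : R) : t \in `]0, T[%R -> `|u t| < d -> `|du t| <= (L + 1) * `|u t|.
  move=> tT utd; have tT' := subitv_oo_cc tT.
  have [_ H1 _] := Hd t tT' (h t) utd.
  rewrite -[du t](subrK (space_diff f (t, h0 t) (u t))).
  apply: le_trans (ler_normD _ _) _; rewrite mulrDl addrC; apply: lerD => //.
  exact: HL.
exact: (G u du d (within_continuousB hc h0c) ud uL hd0).
Qed.

Lemma linear_flow_bound (h0 : R -> 'cV[R]_m) : sol h0 ->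
  exists L : R, 0 <= L /\ forall t : R, t \in `[0, T]%R ->
     forall v : 'cV[R]_m, `|space_diff f (t, h0 t) v| <= L * `|v|.
Proof.
move=> [[h0c h0d] h0O].
by have [[L L0 HL] _] := C0k1_along_path Oo fC1 h0c h0O; exists L.
Qed.

(** Gronwall's inequality run backward with zero error bounds the initial value by a multiple of the
    final one. *)
Lemma linear_flow_injective (h0 y : R -> 'cV[R]_m) : sol h0 ->
  solves_on T (fun t v => space_diff f (t, h0 t) v) y -> y T = 0 -> y 0 = 0.
Proof.
move=> /linear_flow_bound[L [L0 HL]] [yc yd] yT.
have [C C0 G] := gronwall_itv m L0 T0.
have yL (t : R) : t \in `]0, T[%R ->
    `|space_diff f (t, h0 t) (y t)| <= L * `|y t| + 0.
  by move=> tT; rewrite addr0; apply: HL; exact: subitv_oo_cc.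
have TT : T \in `[0, T]%R by rewrite in_itv/= lexx andbT.
have [_] := G y (fun t => space_diff f (t, h0 t) (y t)) 0 (lexx 0) yc yd yL T TT.
by rewrite yT normr0 addr0 mulr0 normr_le0 => /eqP.
Qed.

Lemma space_diff_path_continuous (h0 y : R -> 'cV[R]_m) : sol h0 ->
  {within `[0, T], continuous y} ->
  {within `[0, T], continuous (fun t => space_diff f (t, h0 t) (y t))}.
Proof.
move=> [[h0c _] h0O] yc; have [_ fd] := fC1.
apply/subspace_continuousP => t tT.
apply: cvg_sum => i.
have Dc : forall p, Om p -> {for p, continuous (fun q => 'D_(space_dir R i) f q)}.
  by have [_ [Dc _]] := fd i; exact: Dc.
have /subspace_continuousP/(_ t tT) c1 := path_continuous Dc h0c h0O.
have /subspace_continuousP/(_ t tT) c2 : {within `[0, T], continuous (fun s => y s i 0)}.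
  exact: within_continuous_entry yc.
exact: cvgZ c2 c1.
Qed.

Section family.
Variables (V : normedModType R) (X : set V) (h : V -> R -> 'cV[R]_m).
Hypotheses (Xo : open X) (hsol : forall x, X x -> sol (h x)).

Lemma flow_uniform (x0 : V) : X x0 -> {for x0, continuous (fun x => h x 0)} ->
  forall d : R, 0 < d -> \forall x \near x0, X x /\
    forall t : R, t \in `[0, T]%R -> `|h x t - h x0 t| < d.
Proof.
move=> Xx0 hc d d0; have [C [eta [C0 eta0 H]]] := flow_stable (hsol Xx0).
have dC : 0 < Num.min eta (d / C) by rewrite lt_min eta0 divr_gt0.
have H1 : \forall x \near x0, `|h x0 0 - h x 0| < Num.min eta (d / C).
  by have /cvgrPdist_lt/(_ _ dC) := hc.
have H2 : \forall x \near x0, X x by exact: open_nbhs_nbhs.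
apply: filterS2 H1 H2 => x; rewrite distrC lt_min => /andP[x1 x2] Xx; split=> // t tT.
apply: le_lt_trans (H (h x) (hsol Xx) x1 t tT) _.
by rewrite mulrC -ltr_pdivlMr.
Qed.

(** The difference of the solutions at [x] and [x0] solves the equation at [x0] up to the change of
    Jacobian applied to [y x]. Having no a priori bound, [y x] is split into that difference, which
    goes into the Gronwall constant, and the bounded [y x0]. *)
Lemma linear_flow_continuous (y : V -> R -> 'cV[R]_m) (x0 : V) (t : R) :
  (forall x, X x -> solves_on T (fun s v => space_diff f (s, h x s) v) (y x)) ->
  X x0 -> {for x0, continuous (fun x => h x 0)} ->
  {for x0, continuous (fun x => y x 0)} -> t \in `[0, T]%R ->
  {for x0, continuous (fun x => y x t)}.
Proof.
move=> ysol Xx0 hc yc tT; have [[h0c h0d] h0O] := hsol Xx0.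
have [[L L0 HL] Hinc] := C0k1_along_path Oo fC1 h0c h0O.
have [y0c y0d] := ysol x0 Xx0.
have L10 : 0 <= L + 1 by rewrite addr_ge0.
have [G G0 HG] := gronwall_itv m L10 T0.
have [M M0 HM] : exists2 M : R, 0 <= M & forall s : R, s \in `[0, T]%R -> `|y x0 s| <= M.
  exact: (@path_bounded R _ _ setT (fun p => p.2) (y x0) 0 T
    (fun p _ => cvg_snd) y0c (fun _ _ => I)).
apply/cvgrPdist_lt => k k0.
have G2 : 0 < 2 * G by rewrite mulr_gt0.
have M1 : 0 < M + 1 by rewrite ltr_wpDl.
(* The bound by 1 lets the multiple of [u] be absorbed in [L + 1]; the other makes the error [e * M]
   contribute less than [k / 2], with [M + 1] in place of [M] to avoid dividing by zero. *)
pose e := Num.min 1 (k / (2 * G * (M + 1))).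
have e0 : 0 < e by rewrite lt_min ltr01 divr_gt0// mulr_gt0.
have e1 : e <= 1 by rewrite ge_min lexx.
have eM : G * (e * M) < k / 2.
  apply: le_lt_trans (_ : G * (k / (2 * G * (M + 1)) * M) < _).
    by rewrite ler_wpM2l ?(ltW G0)// ler_wpM2r// ge_min lexx orbT.
  have -> : G * (k / (2 * G * (M + 1)) * M) = (k / 2) * (M / (M + 1)).
    by field; rewrite !gt_eqF.
  by rewrite gtr_pMr ?divr_gt0// ltr_pdivrMr// mul1r ltrDl.
have [d d0 Hd] := Hinc e e0.
have kG : 0 < k / (2 * G) by rewrite divr_gt0.
have N1 := flow_uniform Xx0 hc d0.
have N2 : \forall x \near x0, `|y x0 0 - y x 0| < k / (2 * G).
  by have /cvgrPdist_lt/(_ _ kG) := yc.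
apply: filterS2 N1 N2 => x [Xx hxd] yx0.
have [yxc yxd] := ysol x Xx.
pose u s := y x s - y x0 s.
pose du s := space_diff f (s, h x s) (y x s) - space_diff f (s, h x0 s) (y x0 s).
have ud (s : R) : s \in `]0, T[%R -> is_derive s 1 u (du s).
  by move=> sT; exact: (is_deriveB (yxd s sT) (y0d s sT)).
have uL (s : R) : s \in `]0, T[%R -> `|du s| <= (L + 1) * `|u s| + e * M.
  move=> sT; have sT' := subitv_oo_cc sT.
  have [_ _ H1] := Hd s sT' (h x s) (hxd s sT').
  have {}H1 := H1 (y x s).
  have -> : du s = (space_diff f (s, h x s) (y x s) - space_diff f (s, h x0 s) (y x s)) +
      space_diff f (s, h x0 s) (u s) by rewrite /u space_diffB subrKA.
  have H2 := HL s sT' (u s).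
  have H3 : `|y x s| <= `|u s| + M.
    rewrite -[y x s](subrK (y x0 s)); apply: le_trans (ler_normD _ _) _.
    by rewrite lerD2l; exact: HM.
  apply: le_trans (ler_normD _ _) _.
  apply: le_trans (lerD H1 H2) _.
  have H4 : e * `|y x s| <= `|u s| + e * M.
    apply: le_trans (_ : e * (`|u s| + M) <= _); first by rewrite ler_wpM2l// ltW.
    by rewrite mulrDr lerD2r ler_piMl.
  move: H4; clear; move: (e * `|y x s|) (e * M) `|u s| => a b c; lra.
have eM0 : 0 <= e * M by rewrite mulr_ge0// ltW.
have [H _] := HG u du (e * M) eM0 (within_continuousB yxc y0c) ud uL t tT.
rewrite distrC; apply: le_lt_trans H _; rewrite mulrDr [k]splitr ltrD//.
have -> : k / 2 = G * (k / (2 * G)) by field; rewrite gt_eqF.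
by rewrite ltr_pM2l// distrC.
Qed.


(** * Directional derivative of the flow with respect to the parameter *)

Section derivative.
Variables (x0 e : V) (da : 'cV[R]_m).
Hypotheses (Xx0 : X x0) (aD : is_derive x0 e (fun x => h x 0) da).

Let q (s t : R) : 'cV[R]_m := s^-1 *: (h (s *: e + x0) t - h x0 t).
Let dq (s t : R) : 'cV[R]_m :=
  s^-1 *: (f (t, h (s *: e + x0) t) - f (t, h x0 t)).

(** By [flow_stable] the displacement of the trajectory is at most [C * K] times the size of [s], so
    a linearisation error of relative size [eps / (C * K)] is at most [eps] after division by
    [s]. *)
Let quotient_approx (eps : R) : 0 < eps -> exists2 r : R, 0 < r &
  forall s : R, s != 0 -> `|s| < r ->
  [/\ `|q s 0 - da| <= eps, {within `[0, T], continuous (q s)},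
      forall t : R, t \in `]0, T[%R -> is_derive t 1 (q s) (dq s t) &
      forall t : R, t \in `]0, T[%R ->
        `|dq s t - space_diff f (t, h x0 t) (q s t)| <= eps].
Proof.
move=> eps0; have [[h0c h0d] h0O] := hsol Xx0.
have [_ Hinc] := C0k1_along_path Oo fC1 h0c h0O.
have [C [eta [C0 eta0 Hst]]] := flow_stable (hsol Xx0).
have /is_deriveP aD' := aD.
have [r1 r10 H1] := aD' 1 ltr01.
have [r2 r20 H2] := aD' eps eps0.
pose K := `|da| + 1; have K0 : 0 < K by rewrite ltr_wpDl.
have CK0 : 0 < C * K by rewrite mulr_gt0.
have [d d0 Hd] := Hinc (eps / (C * K)) (divr_gt0 eps0 CK0).
have [r3 r30 H3] : exists2 r : R, 0 < r & forall s : R, `|s| < r -> X (s *: e + x0).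
  have : \forall s \near (0 : R), X (s *: e + x0).
    have c0 : (fun s : R => s *: e + x0) @ (0 : R) --> x0.
      rewrite -[X in _ --> X]add0r -[X in _ --> X + _](scale0r e).
      by apply: cvgD; [apply: cvgZl; exact: cvg_id|exact: cvg_cst].
    by apply: c0; exact: open_nbhs_nbhs.
  move=> /nbhs_ballP[r /= r0 Hr]; exists r => // s sr; apply: Hr.
  by rewrite -ball_normE/= sub0r normrN.
(* In order: accuracy 1 and accuracy [eps] for the initial derivative, membership in [X], the range
   where [flow_stable] applies, and the tube of radius [d]. *)
pose r := Num.min (Num.min r1 r2) (Num.min r3 (Num.min (eta / K) (d / (C * K)))).
exists r; first by rewrite !lt_min r10 r20 r30 !divr_gt0.
move=> s s0; rewrite !lt_min => /andP[/andP[sr1 sr2] /and3P[sr3 seta sd]].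
have ns0 : 0 < `|s| by rewrite normr_gt0.
have Xs := H3 s sr3; have [[hsc hsd] hsO] := hsol Xs.
have init : `|h (s *: e + x0) 0 - h x0 0| <= K * `|s|.
  rewrite -[h (s *: e + x0) 0 - h x0 0](subrK (s *: da)).
  apply: le_trans (ler_normD _ _) _; rewrite /K mulrDl addrC normrZ mulrC lerD2l.
  exact: H1.
have initeta : `|h (s *: e + x0) 0 - h x0 0| < eta.
  by apply: le_lt_trans init _; rewrite mulrC -ltr_pdivlMr.
have bnd (t : R) : t \in `[0, T]%R -> `|h (s *: e + x0) t - h x0 t| <= C * K * `|s|.
  move=> tT; apply: le_trans (Hst _ (hsol Xs) initeta t tT) _.
  by rewrite -mulrA ler_wpM2l// ltW.
have bndd (t : R) : t \in `[0, T]%R -> `|h (s *: e + x0) t - h x0 t| < d.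
  by move=> tT; apply: le_lt_trans (bnd t tT) _; rewrite mulrC -ltr_pdivlMr.
split.
- have -> : q s 0 - da = s^-1 *: (h (s *: e + x0) 0 - h x0 0 - s *: da).
    by rewrite /q [in RHS]scalerBr scalerA mulVf// scale1r.
  by rewrite normrZ normfV mulrC ler_pdivrMr//; exact: H2.
- exact: within_continuousZ (within_continuousB hsc h0c).
- by move=> t tT; exact: (is_deriveZ s^-1 (is_deriveB (hsd t tT) (h0d t tT))).
- move=> t tT; have tT' := subitv_oo_cc tT.
  have [_ H4 _] := Hd t tT' _ (bndd t tT').
  rewrite /dq /q space_diffZ -scalerBr normrZ normfV mulrC ler_pdivrMr//.
  apply: le_trans H4 _.
  apply: le_trans (_ : eps / (C * K) * (C * K * `|s|) <= _).
    by rewrite ler_wpM2l ?bnd// divr_ge0// ltW.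
  by rewrite mulrA divfK// gt_eqF.
Qed.

(** Both quotients nearly solve the same linear equation with nearly the same initial value, so
    Gronwall applies to their difference. *)
Let quotient_cauchy (eps : R) : 0 < eps -> exists2 r : R, 0 < r &
  forall s s' : R, s != 0 -> `|s| < r -> s' != 0 -> `|s'| < r ->
  forall t : R, t \in `[0, T]%R -> `|q s t - q s' t| <= eps.
Proof.
move=> eps0; have [L [L0 HL]] := linear_flow_bound (hsol Xx0).
have [G G0 HG] := gronwall_itv m L0 T0.
(* The 4 counts two errors in the initial values and two in the equation. *)
pose g := eps / (4 * G).
have g0 : 0 < g by rewrite divr_gt0// mulr_gt0.
have [r r0 Hr] := quotient_approx g0; exists r => // s s' s0 sr s'0 s'r t tT.
have [a1 c1 d1 b1] := Hr s s0 sr; have [a2 c2 d2 b2] := Hr s' s'0 s'r.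
pose u t := q s t - q s' t; pose du t := dq s t - dq s' t.
have ud (z : R) : z \in `]0, T[%R -> is_derive z 1 u (du z).
  by move=> zT; exact: (is_deriveB (d1 z zT) (d2 z zT)).
have uL (z : R) : z \in `]0, T[%R -> `|du z| <= L * `|u z| + (g + g).
  move=> zT; have -> : du z = space_diff f (z, h x0 z) (u z) +
      ((dq s z - space_diff f (z, h x0 z) (q s z)) -
       (dq s' z - space_diff f (z, h x0 z) (q s' z))).
    rewrite /du /u space_diffB; apply/matrixP => i j; rewrite !mxE; ring.
  apply: le_trans (ler_normD _ _) _; apply: lerD.
    by apply: HL; exact: subitv_oo_cc.
  apply: le_trans (ler_normB _ _) _; apply: lerD; [exact: b1|exact: b2].
have u0 : `|u 0| <= g + g.
  have -> : u 0 = (q s 0 - da) - (q s' 0 - da) by rewrite /u opprB subrKA.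
  by apply: le_trans (ler_normB _ _) _; apply: lerD.
have gg0 : 0 <= g + g by rewrite addr_ge0// ltW.
have [H _] := HG u du (g + g) gg0 (within_continuousB c1 c2) ud uL t tT.
apply: le_trans H _.
have -> : eps = G * (g + g + (g + g)) by rewrite /g; field; rewrite gt_eqF.
by rewrite ler_wpM2l ?(ltW G0)// lerD2r.
Qed.

(** Existence of the limit comes from completeness: the quotients are Cauchy as [s] tends to 0. *)
Lemma flow_derivable (t : R) : t \in `[0, T]%R -> derivable (fun x => h x t) x0 e.
Proof.
move=> tT; apply: cauchy_cvg; apply: cauchy_exP => eps eps0.
have eps2 : 0 < eps / 2 by rewrite divr_gt0.
have [r r0 Hr] := quotient_cauchy eps2.
have r2 : 0 < r / 2 by rewrite divr_gt0.
have r2r : `|r / 2| < r by rewrite gtr0_norm// ltr_pdivrMr// ltr_pMr// ltr1n.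
exists (q (r / 2) t); apply/nbhs_ballP; exists r => //= s.
rewrite -ball_normE/= sub0r normrN => sr s0; rewrite -ball_normE/=.
apply: le_lt_trans (Hr (r / 2) s (lt0r_neq0 r2) r2r s0 sr t tT) _.
by rewrite ltr_pdivrMr// ltr_pMr// ltr1n.
Qed.

(** Let [s'] tend to 0 in [quotient_cauchy]; how small [s'] must be may depend on [t], but [r] does
    not. *)
Let quotient_uniform (eps : R) : 0 < eps -> exists2 r : R, 0 < r &
  forall s : R, s != 0 -> `|s| < r ->
  forall t : R, t \in `[0, T]%R -> `|q s t - 'D_e (fun x => h x t) x0| <= eps.
Proof.
move=> eps0; have [r r0 Hr] := quotient_cauchy eps0; exists r => // s s0 sr t tT.
apply/ler_addgt0Pr => g g0.
have qD : (fun s' => q s' t) @ 0^' --> 'D_e (fun x => h x t) x0.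
  by have /cvg_ex[l ql] := flow_derivable tT; rewrite /derive (cvg_lim _ ql).
have N1 : \forall s' \near 0^', `|'D_e (fun x => h x t) x0 - q s' t| <= g.
  by move/cvgrPdist_le : qD; apply.
have [s' [s'1 s'2 s'3]] := dnbhs0_witness N1 r0.
rewrite -(subrKA (q s' t)); apply: le_trans (ler_normD _ _) _; apply: lerD.
  exact: Hr.
by rewrite distrC.
Qed.

(** The [q s] converge uniformly to the derivative, and the [dq s] to the right-hand side.
    Continuity of the limit is settled first, because [uniform_limit_derive] needs a continuous
    right-hand side. *)
Lemma flow_derive_solves :
  solves_on T (fun t v => space_diff f (t, h x0 t) v)
    (fun t => 'D_e (fun x => h x t) x0).
Proof.
have yc : {within `[0, T], continuous (fun t => 'D_e (fun x => h x t) x0)}.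
  apply: uniform_limit_continuous => eps eps0.
  have [r1 r10 H1] := quotient_uniform eps0.
  have [r2 r20 H2] := quotient_approx eps0.
  have [s [s1 s2 s3]] := dnbhs0_witness (dnbhs0_lt r10) r20.
  have [_ qc _ _] := H2 s s3 s2.
  by exists (q s) => //; exact: H1.
split=> // t tT.
apply: (@uniform_limit_derive R m 0 T (fun t => 'D_e (fun x => h x t) x0)
  (fun t => space_diff f (t, h x0 t) ('D_e (fun x => h x t) x0))); last exact: tT.
  move=> eps eps0; have [L [L0 HL]] := linear_flow_bound (hsol Xx0).
  have L1 : 0 < L + 1 by rewrite ltr_wpDl.
  (* [dq s] misses the linear field at [q s] by at most [g], and passing from [q s] to its limit
     costs [L * g]. *)
  pose g := eps / (L + 1).
  have g0 : 0 < g by rewrite divr_gt0.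
  have Eg : L * g + g = eps by rewrite /g; field; rewrite gt_eqF.
  have geps : g <= eps by rewrite -Eg lerDr mulr_ge0// ltW.
  have [r1 r10 H1] := quotient_uniform g0.
  have [r2 r20 H2] := quotient_approx g0.
  have [s [s1 s2 s3]] := dnbhs0_witness (dnbhs0_lt r10) r20.
  have [_ qc qd qK] := H2 s s3 s2.
  exists (q s), (dq s); split.
  - exact: qc.
  - by move=> z zT; apply: le_trans (H1 s s3 s1 z zT) geps.
  - exact: qd.
  - move=> z zT; rewrite -(subrKA (space_diff f (z, h x0 z) (q s z))).
    apply: le_trans (ler_normD _ _) _; rewrite -Eg addrC -space_diffB; apply: lerD.
      apply: le_trans (HL z (subitv_oo_cc zT) _) _.
      by rewrite ler_wpM2l//; exact: (H1 s s3 s1 z (subitv_oo_cc zT)).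
    exact: qK.
exact: space_diff_path_continuous (hsol Xx0) yc.
Qed.

End derivative.
End family.
End flow.

(** * Calculus of C^k functions along a family of directions *)

Lemma continuous_at_eq_on (R : realType) (V W : normedModType R) (U : set V)
    (f g : V -> W) (x : V) : open U -> (forall y, U y -> f y = g y) -> U x ->
  {for x, continuous f} -> {for x, continuous g}.
Proof.
move=> Uo fg Ux fc; have N : \forall y \near x, U y by exact: open_nbhs_nbhs.
rewrite /prop_for/continuous_at -(fg x Ux); apply: cvg_trans fc.
by apply: near_eq_cvg; apply: filterS N => y /fg.
Qed.

Lemma is_derive_eq_on (R : realType) (V W : normedModType R) (U : set V)
    (f g : V -> W) (x v : V) (l : W) : open U -> (forall y, U y -> f y = g y) ->
  U x -> is_derive x v f l -> is_derive x v g l.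
Proof.
move=> Uo fg Ux; apply: near_eq_is_derive.
have N : \forall y \near x, U y by exact: open_nbhs_nbhs.
by apply: filterS N => y /fg.
Qed.

Lemma is_derive_linear_comp (R : realType) (V W W' : normedModType R)
    (L : {linear W -> W'}) (f : V -> W) (x v : V) (l : W) :
  continuous L -> is_derive x v f l -> is_derive x v (fun y => L (f y)) (L l).
Proof.
move=> Lc /is_deriveP H; apply/is_deriveP => e e0.
have [k k0 Hk] := linear_lipschitz Lc.
have [d d0 {}H] := H (e / k) (divr_gt0 e0 k0); exists d => // h hd.
rewrite -linearB -linearZ -linearB; apply: le_trans (Hk _) _.
by rewrite mulrC -ler_pdivlMr// mulrAC; exact: H.
Qed.

Lemma is_derive_comp_linear (R : realType) (V V' W : normedModType R)
    (L : V' -> V) (f : V -> W) (x v : V') (l : W) :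
  (forall (c : R) u w, L (c *: u + w) = c *: L u + L w) ->
  is_derive (L x) (L v) f l -> is_derive x v (fun y => f (L y)) l.
Proof.
move=> LL /is_deriveP H; apply/is_deriveP => e e0.
have [d d0 {}H] := H e e0; exists d => // h hd; rewrite LL; exact: H.
Qed.

Lemma is_derive_scale (R : realType) (V W : normedModType R)
    (c : V -> R) (g : V -> W) (x v : V) (dc : R) (dg : W) :
  {for x, continuous c} -> is_derive x v c dc -> is_derive x v g dg ->
  is_derive x v (fun y => c y *: g y) (c x *: dg + dc *: g x).
Proof.
move=> cc [/cvg_ex[c' cD] cE] [/cvg_ex[g' gD] gE].
have {}cE : c' = dc by rewrite -cE; apply/esym/cvg_lim.
have {}gE : g' = dg by rewrite -gE; apply/esym/cvg_lim.
rewrite {}cE {}gE in cD gD.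
have c0 : (fun s : R => c (s *: v + x)) @ 0^' --> c x.
  have H : (fun s : R => s *: v + x) @ 0^' --> x.
    apply: cvg_trans (_ : (fun s : R => s *: v + x) @ (0 : R) --> x).
      exact/cvg_app/cvg_within.
    rewrite -[X in _ --> X]add0r -[X in _ --> X + _](scale0r v).
    by apply: cvgD; [apply: cvgZl; exact: cvg_id|exact: cvg_cst].
  exact: (cvg_comp _ _ H cc).
have H : (fun h : R => h^-1 *: (c (h *: v + x) *: g (h *: v + x) - c x *: g x)) @ 0^'
    --> c x *: dg + dc *: g x.
  have E (h : R) : h^-1 *: (c (h *: v + x) *: g (h *: v + x) - c x *: g x) =
      c (h *: v + x) *: (h^-1 *: (g (h *: v + x) - g x)) +
      (h^-1 *: (c (h *: v + x) - c x)) *: g x.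
    rewrite scalerA [c _ * _]mulrC -!scalerA -scalerDr; congr (_ *: _).
    by rewrite scalerBr scalerBl addrA subrK.
  under eq_cvg do rewrite E.
  by apply: cvgD; [exact: cvgZ c0 gD|exact: cvgZl cD].
by split; [apply/cvg_ex; eexists; exact: H|exact: cvg_lim].
Qed.

Section Ck_along.
Variables (R : realType) (V : normedModType R) (p : nat) (e : 'I_p -> V).
Variables (U : set V) (Uo : open U).

Lemma Ck_along_continuous (W : normedModType R) k (f : V -> W) :
  Ck_along e U k f -> forall x, U x -> {for x, continuous f}.
Proof. by case: k => [|k] []. Qed.

Lemma Ck_along_derive (W : normedModType R) k (f : V -> W) (i : 'I_p) :
  Ck_along e U k.+1 f -> Ck_along e U k (fun x => 'D_(e i) f x).
Proof. by move=> [_ /(_ i)[]]. Qed.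

Lemma Ck_along_is_derive (W : normedModType R) k (f : V -> W) (i : 'I_p) x :
  Ck_along e U k.+1 f -> U x -> is_derive x (e i) f ('D_(e i) f x).
Proof. by move=> [_ /(_ i)[fd _]] Ux; apply: derivableP; exact: fd. Qed.

(** As [U] is open, derivatives at its points see only values in [U]; whatever the total functions
    ['D_(e i) f] take outside is ignored. *)
Lemma Ck_along_eq_on (W : normedModType R) k (f g : V -> W) :
  (forall x, U x -> f x = g x) -> Ck_along e U k f -> Ck_along e U k g.
Proof.
elim: k f g => [|k IH] f g fg [fc fd].
  by split=> // x Ux; exact: continuous_at_eq_on fg Ux (fc x Ux).
split; first by move=> x Ux; exact: continuous_at_eq_on fg Ux (fc x Ux).
move=> i; have [fdi fCk] := fd i.
have gD x : U x -> is_derive x (e i) g ('D_(e i) f x).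
  by move=> Ux; apply: is_derive_eq_on fg Ux (derivableP (fdi x Ux)).
split; first by move=> x /gD[].
by apply: IH fCk => x /gD[].
Qed.

(** Lets a formula valid on [U] stand for the derivative, so that closure properties follow by
    induction from the usual rules of differentiation. *)
Lemma Ck_along_intro (W : normedModType R) k (f : V -> W) (df : 'I_p -> V -> W) :
  (forall x, U x -> {for x, continuous f}) ->
  (forall i x, U x -> is_derive x (e i) f (df i x)) ->
  (forall i, Ck_along e U k (df i)) -> Ck_along e U k.+1 f.
Proof.
move=> fc fD dfCk; split=> // i; split; first by move=> x /(fD i)[].
by apply: Ck_along_eq_on (dfCk i) => x /(fD i)[].
Qed.

Lemma Ck_alongW (W : normedModType R) k (f : V -> W) :
  Ck_along e U k.+1 f -> Ck_along e U k f.
Proof.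
elim: k f => [|k IH] f [fc fd]; first by split.
by split=> // i; have [fdi /IH] := fd i.
Qed.

Lemma Ck_along_le (W : normedModType R) j k (f : V -> W) : (j <= k)%N ->
  Ck_along e U k f -> Ck_along e U j f.
Proof.
move=> /subnK <-; elim: (k - j)%N => // l IH.
by rewrite addSn => /Ck_alongW.
Qed.

Lemma Ck_along_cst (W : normedModType R) k (w : W) : Ck_along e U k (fun=> w).
Proof.
elim: k w => [|k IH] w; first by split=> // x _; exact: cvg_cst.
exact: (Ck_along_intro (fun x _ => cvg_cst _)
  (fun i x _ => is_derive_cst w x (e i)) (fun=> IH 0)).
Qed.

Lemma Ck_along_add (W : normedModType R) k (f g : V -> W) :
  Ck_along e U k f -> Ck_along e U k g -> Ck_along e U k (fun x => f x + g x).
Proof.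
elim: k f g => [|k IH] f g Cf Cg.
  split=> // x Ux; apply: cvgD; [exact: Ck_along_continuous Cf x Ux|].
  exact: Ck_along_continuous Cg x Ux.
apply: (Ck_along_intro _ (fun i x Ux => is_deriveD (Ck_along_is_derive i Cf Ux)
    (Ck_along_is_derive i Cg Ux))).
  move=> x Ux; apply: cvgD; [exact: Ck_along_continuous Cf x Ux|].
  exact: Ck_along_continuous Cg x Ux.
by move=> i; apply: IH; exact: Ck_along_derive.
Qed.

Lemma Ck_along_sum (W : normedModType R) k n (f : 'I_n -> V -> W) :
  (forall i, Ck_along e U k (f i)) -> Ck_along e U k (fun x => \sum_i f i x).
Proof.
move=> H; suff S (s : seq 'I_n) : Ck_along e U k (fun x => \sum_(i <- s) f i x) by exact: S.
elim: s => [|i s IH].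
  by under eq_fun do rewrite big_nil; exact: Ck_along_cst.
by under eq_fun do rewrite big_cons; exact: Ck_along_add.
Qed.

Lemma Ck_along_scale (W : normedModType R) k (c : V -> R) (g : V -> W) :
  Ck_along e U k c -> Ck_along e U k g -> Ck_along e U k (fun x => c x *: g x).
Proof.
elim: k c g => [|k IH] c g Cc Cg.
  split=> // x Ux; apply: cvgZ; [exact: Ck_along_continuous Cc x Ux|].
  exact: Ck_along_continuous Cg x Ux.
apply: (Ck_along_intro _ (fun i x Ux => is_derive_scale
    (Ck_along_continuous Cc Ux) (Ck_along_is_derive i Cc Ux)
    (Ck_along_is_derive i Cg Ux))).
- move=> x Ux; apply: cvgZ; [exact: Ck_along_continuous Cc x Ux|].
  exact: Ck_along_continuous Cg x Ux.
- move=> i; apply: Ck_along_add; apply: IH.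
  + exact: Ck_alongW.
  + exact: Ck_along_derive.
  + exact: Ck_along_derive.
  + exact: Ck_alongW.
Qed.

Lemma Ck_along_linear_comp (W W' : normedModType R) k (L : {linear W -> W'})
    (f : V -> W) : continuous L ->
  Ck_along e U k f -> Ck_along e U k (fun x => L (f x)).
Proof.
move=> Lc; elim: k f => [|k IH] f Cf.
  by split=> // x Ux; exact: (cvg_comp _ _ (Ck_along_continuous Cf Ux) (Lc _)).
apply: (Ck_along_intro _ (fun i x Ux => is_derive_linear_comp Lc
    (Ck_along_is_derive i Cf Ux))).
  by move=> x Ux; exact: (cvg_comp _ _ (Ck_along_continuous Cf Ux) (Lc _)).
by move=> i; apply: IH; exact: Ck_along_derive.
Qed.

Lemma Ck_along_linear (W : normedModType R) k (L : V -> W) : continuous L ->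
  (forall (c : R) u w, L (c *: u + w) = c *: L u + L w) -> Ck_along e U k L.
Proof.
move=> Lc LL; case: k => [|k]; first by split=> // x _; exact: Lc.
have LD i x : U x -> is_derive x (e i) L (L (e i)).
  move=> _; apply/is_deriveP => g g0; exists 1 => // h _.
  by rewrite LL addrK subrr normr0 mulr_ge0// ltW.
exact: (Ck_along_intro (fun x _ => Lc x) LD (fun i => Ck_along_cst k (L (e i)))).
Qed.

End Ck_along.

(** Differentiating along [e' j] differentiates [f] along [L (e' j)]; as this is 0 or a member of
    [e], iterated derivatives never leave the family. *)
Lemma Ck_along_comp_linear (R : realType) (V V' W : normedModType R) (p p' : nat)
    (e : 'I_p -> V) (e' : 'I_p' -> V') (U : set V) (L : V' -> V) k (f : V -> W) :
  open U -> continuous L ->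
  (forall (c : R) u w, L (c *: u + w) = c *: L u + L w) ->
  (forall j, L (e' j) = 0 \/ exists i, L (e' j) = e i) ->
  Ck_along e U k f -> Ck_along e' (L @^-1` U) k (fun x => f (L x)).
Proof.
move=> Uo Lc LL Le; have LUo : open (L @^-1` U) by apply: open_comp.
elim: k f => [|k IH] f Cf.
  by split=> // x Ux; exact: (cvg_comp _ _ (Lc x) (Ck_along_continuous Cf Ux)).
split; first by move=> x Ux; exact: (cvg_comp _ _ (Lc x) (Ck_along_continuous Cf Ux)).
move=> j; have [Lj0|[i Lji]] := Le j.
  have D x : is_derive x (e' j) (fun y => f (L y)) 0.
    by apply: is_derive_comp_linear LL _; rewrite Lj0; exact: is_derive0.
  split; first by move=> x _; have [] := D x.
  apply: (Ck_along_eq_on LUo) (Ck_along_cst _ LUo k 0) => x _.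
  by have [_ ->] := D x.
have D x : U (L x) -> is_derive x (e' j) (fun y => f (L y)) ('D_(e i) f (L x)).
  move=> Ux; apply: is_derive_comp_linear LL _; rewrite Lji.
  exact: Ck_along_is_derive Cf Ux.
split; first by move=> x /D[].
by apply: (Ck_along_eq_on LUo) (IH _ (Ck_along_derive i Cf)) => x /D[].
Qed.

(** * Dependence of the flow on its initial value, higher order *)

Lemma mulmx_continuous (R : realType) (m n : nat) (A : 'M[R]_(m, n)) :
  continuous (mulmx A : 'cV[R]_n -> 'cV[R]_m).
Proof.
have -> : (mulmx A : 'cV[R]_n -> 'cV[R]_m) = fun u => \sum_j u j 0 *: col j A.
  apply/funext => u; apply/matrixP => i k; rewrite (ord1 k) !mxE summxE.
  by apply: eq_bigr => j _; rewrite !mxE mulrC.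
move=> u; apply: (@cvg_sum R _ (nbhs u) 'cV[R]_m n (fun j v => v j 0 *: col j A)) => j.
exact: (cvgZl (@coord_continuous R n 1 j 0 u)).
Qed.

Lemma is_derive_mulmx (R : realType) (m n : nat) (A : 'M[R]_(m, n))
    (u : R -> 'cV[R]_n) (t : R) (du : 'cV[R]_n) :
  is_derive t 1 u du -> is_derive t 1 (fun s => A *m u s) (A *m du).
Proof. exact: (is_derive_linear_comp (@mulmx_continuous R m n A)). Qed.

Lemma within_continuous_mulmx (R : realType) (m n : nat) (A : 'M[R]_(m, n))
    (D : set R) (u : R -> 'cV[R]_n) :
  {within D, continuous u} -> {within D, continuous (fun s => A *m u s)}.
Proof.
move=> /subspace_continuousP uc; apply/subspace_continuousP => t tD.
exact: (cvg_comp _ _ (uc t tD) (@mulmx_continuous R m n A _)).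
Qed.

Lemma Ck_along_mulmx (R : realType) (V : normedModType R) (p : nat)
    (e : 'I_p -> V) (U : set V) (k m n : nat) (A : 'M[R]_(m, n)) (f : V -> 'cV[R]_n) :
  open U -> Ck_along e U k f -> Ck_along e U k (fun x => A *m f x).
Proof. by move=> Uo; apply: Ck_along_linear_comp => //; exact: mulmx_continuous. Qed.

(* The state [z] of the system formed by an ODE and its variational equation
   stacks the solution [upP *m z] on its derivative [downP *m z]. *)
Section variational_system.
Variables (R : realType) (m : nat).

Definition upP : 'M[R]_(m, m + m) := row_mx 1%:M 0.
Definition downP : 'M[R]_(m, m + m) := row_mx 0 1%:M.
Definition stack (u v : 'cV[R]_m) : 'cV[R]_(m + m) := upP^T *m u + downP^T *m v.

Lemma upP_stack u v : upP *m stack u v = u.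
Proof.
rewrite /stack mulmxDr !mulmxA /upP /downP !tr_row_mx !mul_row_col.
by rewrite !trmx1 !trmx0 !(mulmx1, mulmx0, mul0mx, addr0, mul1mx).
Qed.

Lemma downP_stack u v : downP *m stack u v = v.
Proof.
rewrite /stack mulmxDr !mulmxA /upP /downP !tr_row_mx !mul_row_col.
by rewrite !trmx1 !trmx0 !(mulmx1, mulmx0, mul0mx, add0r, mul1mx).
Qed.

Definition up_space (q : R * 'cV[R]_(m + m)) : R * 'cV[R]_m := (q.1, upP *m q.2).

Definition variational_field (f : R * 'cV[R]_m -> 'cV[R]_m)
    (q : R * 'cV[R]_(m + m)) : 'cV[R]_(m + m) :=
  stack (f (up_space q)) (space_diff f (up_space q) (downP *m q.2)).

Lemma up_space_continuous : continuous up_space.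
Proof.
move=> q; have c2 : (fun p : R * 'cV[R]_(m + m) => upP *m p.2) @ q --> upP *m q.2.
  exact: (@continuous_comp _ _ _ snd (mulmx upP) q (@cvg_snd _ _ (nbhs q.1) (nbhs q.2) _)
    (@mulmx_continuous R _ _ upP q.2)).
have c1 : (fun p : R * 'cV[R]_(m + m) => p.1) @ q --> q.1 by exact: cvg_fst.
exact: (cvg_pair c1 c2).
Qed.

Lemma up_space_linear (c : R) u w :
  up_space (c *: u + w) = c *: up_space u + up_space w.
Proof. by apply: injective_projections => //=; rewrite mulmxDr -scalemxAr. Qed.

Lemma up_space_dir (j : 'I_(m + m)) : up_space (space_dir R j) = 0 \/
  exists i, up_space (space_dir R j) = space_dir R i.
Proof.
have E : upP *m basis_vec R j = col j upP by rewrite /basis_vec -colE.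
case: (split_ordP j) E => i -> E; [right; exists i|left].
  apply: injective_projections => //=; rewrite E /upP colKl.
  by apply/matrixP => a b; rewrite (ord1 b) /basis_vec !mxE eqxx andbT.
by apply: injective_projections => //=; rewrite E /upP colKr col0.
Qed.

(** The lower block is a sum of products of a coordinate of [downP *m q.2], linear in the state,
    with a partial derivative of [f]; the latter costs one order. *)
Lemma C0k_variational_field (k : nat) (Om : set (R * 'cV[R]_m))
    (f : R * 'cV[R]_m -> 'cV[R]_m) :
  open Om -> C0k k.+1 Om f -> C0k k (up_space @^-1` Om) (variational_field f).
Proof.
move=> Oo Cf; have Oo2 : open (up_space @^-1` Om).
  by apply: open_comp => // q _; exact: up_space_continuous.
have comp (g : R * 'cV[R]_m -> 'cV[R]_m) : C0k k Om g ->
    Ck_along (@space_dir R (m + m)) (up_space @^-1` Om) k (fun q => g (up_space q)).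
  exact: (Ck_along_comp_linear Oo up_space_continuous up_space_linear up_space_dir).
apply: (Ck_along_add Oo2); apply: (Ck_along_mulmx _ Oo2).
  exact: (comp _ (Ck_alongW Cf)).
apply: (Ck_along_sum Oo2) => i; apply: (Ck_along_scale Oo2); last first.
  exact: (comp _ (Ck_along_derive i Cf)).
pose L (q : R * 'cV[R]_(m + m)) : R := (downP *m q.2) i 0.
have Lc : continuous L.
  move=> q; have c2 : (fun p : R * 'cV[R]_(m + m) => downP *m p.2) @ q --> downP *m q.2.
    exact: (@continuous_comp _ _ _ snd (mulmx downP) q
      (@cvg_snd _ _ (nbhs q.1) (nbhs q.2) _) (@mulmx_continuous R _ _ downP q.2)).
  exact: (cvg_comp _ _ c2 (@coord_continuous R m 1 i 0 _)).
have LL (c : R) u w : L (c *: u + w) = c *: L u + L w.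
  by rewrite /L /= mulmxDr -scalemxAr !mxE.
exact: (Ck_along_linear _ Oo2 k Lc LL).
Qed.

End variational_system.

(** A directional derivative of the flow is the lower half of a solution of the stacked system. The
    order lost by the field is recovered because the induction hypothesis then concerns a derivative
    of the flow. The stacked initial value contains derivatives of the old one, hence the general
    hypothesis on [h x 0]. *)
Lemma flow_Ck (R : realType) (V : normedModType R) (p : nat) (e : 'I_p -> V)
    (X : set V) (k m : nat) (T : R) (Om : set (R * 'cV[R]_m))
    (f : R * 'cV[R]_m -> 'cV[R]_m) (h : V -> R -> 'cV[R]_m) :
  0 <= T -> open X -> open Om -> C0k k.+1 Om f ->
  (forall x, X x -> solves_on T (fun t v => f (t, v)) (h x) /\
    forall t : R, t \in `[0, T]%R -> Om (t, h x t)) ->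
  Ck_along e X k.+1 (fun x => h x 0) ->
  forall t : R, t \in `[0, T]%R -> Ck_along e X k.+1 (fun x => h x t).
Proof.
move=> T0 Xo; elim: k m Om f h => [|k IH] m Om f h Oo Cf hsol C0 t tT.
all: have Cf1 : C0k 1 Om f by exact: Ck_along_le Cf.
all: have zT : 0 \in `[0, T]%R by rewrite in_itv/= lexx.
all: have h0c := Ck_along_continuous C0.
all: have hc x : X x -> {for x, continuous (fun y => h y t)} by
  move=> Xx; apply/cvgrPdist_lt => d d0;
  apply: filterS (flow_uniform T0 Oo Cf1 Xo hsol Xx (h0c x Xx) d0) => y [_ H];
  rewrite distrC; exact: H.
all: have hD i x (s : R) (Xx : X x) (sT : s \in `[0, T]%R) :=
  derivableP (flow_derivable T0 Oo Cf1 Xo hsol Xx (Ck_along_is_derive i C0 Xx) sT).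
all: have yS i x (Xx : X x) :=
  flow_derive_solves T0 Oo Cf1 Xo hsol Xx (Ck_along_is_derive i C0 Xx).
  (* At order 1 only continuity of the derivatives remains, and they solve the variational
     equation. *)
  apply: (Ck_along_intro Xo hc (fun i x Xx => hD i x t Xx tT)) => i; split=> // x Xx.
  apply: (linear_flow_continuous T0 Oo Cf1 Xo hsol (yS i) Xx (h0c x Xx) _ tT).
  exact: Ck_along_continuous (Ck_along_derive i C0) x Xx.
apply: (Ck_along_intro Xo hc (fun i x Xx => hD i x t Xx tT)) => i.
pose h2 x s := stack (h x s) ('D_(e i) (fun y => h y s) x).
suff H : Ck_along e X k.+1 (fun x => h2 x t).
  apply: (Ck_along_eq_on Xo) (Ck_along_mulmx (downP R m) Xo H) => x Xx.
  exact: downP_stack.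
apply: (IH _ (@up_space R m @^-1` Om) (variational_field f)) tT.
- by apply: open_comp => // q _; exact: up_space_continuous.
- exact: C0k_variational_field.
- move=> x Xx; have [[hxc hxd] hxO] := hsol x Xx; have [yc yd] := yS i x Xx.
  have upE s : up_space (s, h2 x s) = (s, h x s) by rewrite /up_space /= upP_stack.
  split; last by move=> s sT; rewrite /= upE; exact: hxO.
  split.
    apply/subspace_continuousP => s sT; apply: cvgD.
      by have /subspace_continuousP := within_continuous_mulmx (A := (upP R m)^T) hxc; apply.
    by have /subspace_continuousP := within_continuous_mulmx (A := (downP R m)^T) yc; apply.
  move=> s sT; rewrite /variational_field upE downP_stack.
  exact: (is_deriveD (is_derive_mulmx _ (hxd s sT)) (is_derive_mulmx _ (yd s sT))).
- apply: (Ck_along_add Xo); apply: (Ck_along_mulmx _ Xo); first exact: Ck_alongW C0.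
  exact: Ck_along_derive C0.
Qed.

(** * Neural ODEs *)

(** The columns of [cokermx B] are killed by [B], hence by [A]; this puts the rows of [A] in the row
    space of [B]. *)
Lemma rank_le_ker (R : realType) (m n : nat) (A B : 'M[R]_(m, n)) :
  (forall u : 'cV[R]_n, B *m u = 0 -> A *m u = 0) -> (\rank A <= \rank B)%N.
Proof.
move=> H; apply: mxrankS; rewrite submxE; apply/eqP/matrixP => i j.
have Bj : B *m col j (cokermx B) = 0 by rewrite colE mulmxA mulmx_coker mul0mx.
have := congr1 (fun M : 'cV[R]_m => M i 0) (H _ Bj).
by rewrite colE mulmxA -colE !mxE.
Qed.

Lemma solves_on_lincomb (R : realType) (m n : nat) (T : R)
    (f : R * 'cV[R]_m -> 'cV[R]_m) (h : R -> 'cV[R]_m) (y : 'I_n -> R -> 'cV[R]_m)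
    (c : 'I_n -> R) :
  (forall i, solves_on T (fun t v => space_diff f (t, h t) v) (y i)) ->
  solves_on T (fun t v => space_diff f (t, h t) v) (fun t => \sum_i c i *: y i t).
Proof.
move=> yS; split.
  apply/subspace_continuousP => t tT.
  apply: cvg_sum => i; have [yc _] := yS i.
  by have /subspace_continuousP := within_continuousZ (c := c i) yc; apply.
move=> t tT.
have -> : space_diff f (t, h t) (\sum_i c i *: y i t) =
    \sum_i c i *: space_diff f (t, h t) (y i t).
  elim/big_ind2 : _ => [|u1 v1 u2 v2 <- <-|i _].
  - by have := space_diffZ f (t, h t) 0 0; rewrite !scale0r.
  - by rewrite -[v2 in LHS]opprK space_diffB -[- v2]scaleN1r space_diffZ scaleN1r opprK.
  - by rewrite space_diffZ.
have -> : (fun s => \sum_i c i *: y i s) = \sum_i (fun s => c i *: y i s).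
  by apply/funext => s; rewrite fct_sumE.
apply: is_derive_sum => i; have [_ yd] := yS i.
exact: (is_deriveZ (c i) (yd t tT)).
Qed.

Section neural_ode.
Variables (R : realType) (T : R) (n m k : nat) (X : set 'cV[R]_n).
Variables (W : 'M[R]_(m, n)) (b : 'cV[R]_m) (Wt : 'M[R]_(1, m)) (bt : R).
Variable Phi : 'cV[R]_n -> R.
Variables (Om : set (R * 'cV[R]_m)) (f : R * 'cV[R]_m -> 'cV[R]_m).
Variable h : 'cV[R]_n -> R -> 'cV[R]_m.
Hypotheses (T0 : 0 <= T) (Xo : open X) (Oo : open Om) (Cf : C0k k.+1 Om f).
Hypothesis hsol : forall x, X x -> solves_on T (fun t v => f (t, v)) (h x) /\
  forall t : R, t \in `[0, T]%R -> Om (t, h x t).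
Hypothesis h0 : forall x, X x -> h x 0 = W *m x + b.
Hypothesis PhiE : forall x, X x -> Phi x = (Wt *m h x T) 0 0 + bt.

Let TT : T \in `[0, T]%R. Proof. by rewrite in_itv/= lexx andbT. Qed.

Let init_Ck j : Ck_along (@basis_vec R n) X j (fun x => h x 0).
Proof.
apply: (@Ck_along_eq_on _ _ _ _ _ Xo _ _ (fun x => W *m x + b)).
  by move=> x Xx; rewrite h0.
apply: (Ck_along_add Xo); last exact: Ck_along_cst.
apply: (Ck_along_linear _ Xo); first exact: mulmx_continuous.
by move=> c u w; rewrite mulmxDr scalemxAr.
Qed.

Let init_derive i x : X x -> 'D_(basis_vec R i) (fun y => h y 0) x = W *m basis_vec R i.
Proof.
move=> Xx; apply: derive_val.
apply: (@is_derive_eq_on _ _ _ X (fun x => W *m x + b)) (Xx) _ => //.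
  by move=> y Xy; rewrite h0.
apply/is_deriveP => e e0; exists 1 => // d _.
rewrite mulmxDr -scalemxAr.
have E (p q : 'cV[R]_m) : d *: p + q + b - (q + b) - d *: p = 0.
  by apply/matrixP => r c; rewrite !mxE; ring.
by rewrite E normr0 mulr_ge0// ltW.
Qed.

Let flowT_Ck : Ck_along (@basis_vec R n) X k.+1 (fun x => h x T).
Proof. exact: (flow_Ck T0 Xo Oo Cf hsol (init_Ck k.+1) TT). Qed.

Let output (v : 'cV[R]_m) : R := (Wt *m v) 0 0.

Let output_linear : linear output.
Proof. by move=> c u w; rewrite /output mulmxDr -scalemxAr !mxE. Qed.

HB.instance Definition _ := GRing.isLinear.Build R 'cV[R]_m R _ output output_linear.

Let output_continuous : continuous output.
Proof.
move=> v.
exact: (cvg_comp _ _ (@mulmx_continuous R _ _ Wt v) (@coord_continuous R 1 1 0 0 _)).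
Qed.

Lemma neural_ode_Ck : Ck k.+1 X Phi.
Proof.
apply: (@Ck_along_eq_on _ _ _ _ _ Xo _ _ (fun x => output (h x T) + bt)).
  by move=> x Xx; rewrite PhiE.
apply: (Ck_along_add Xo); last exact: Ck_along_cst.
exact: (Ck_along_linear_comp Xo output_continuous flowT_Ck).
Qed.

Let y (x : 'cV[R]_n) (i : 'I_n) (t : R) : 'cV[R]_m :=
  'D_(basis_vec R i) (fun z => h z t) x.

Lemma neural_ode_derive i x : X x ->
  'D_(basis_vec R i) Phi x = (Wt *m y x i T) 0 0.
Proof.
move=> Xx; apply: derive_val.
apply: (@is_derive_eq_on _ _ _ X (fun x => output (h x T) + bt)) (Xx) _ => //.
  by move=> z Xz; rewrite PhiE.
rewrite -[_ 0 0]addr0; apply: is_deriveD.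
exact: (is_derive_linear_comp output_continuous (Ck_along_is_derive i flowT_Ck Xx)).
Qed.

Lemma neural_ode_no_critical_point x : \rank W = m -> \rank Wt = 1%N -> X x ->
  grad Phi x <> 0.
Proof.
move=> rW rWt Xx gr0.
have Cf1 : C0k 1 Om f by exact: Ck_along_le Cf.
have yS i : solves_on T (fun t v => space_diff f (t, h x t) v) (y x i).
  exact: (flow_derive_solves T0 Oo Cf1 Xo hsol Xx (Ck_along_is_derive i (init_Ck 1) Xx)).
(* The columns are the partial derivatives of the flow, so [Z t *m u] solves the variational
   equation with initial value [W *m u]. *)
pose Z (t : R) : 'M[R]_(m, n) := \matrix_(r, i) y x i t r 0.
have ZE t (u : 'cV[R]_n) : Z t *m u = \sum_i u i 0 *: y x i t.
  apply/matrixP => r c; rewrite (ord1 c) !mxE summxE.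
  by apply: eq_bigr => i _; rewrite !mxE mulrC.
have Z0 : Z 0 = W.
  by apply/matrixP => r i; rewrite mxE /y init_derive// /basis_vec -colE mxE.
have rZ : (\rank W <= \rank (Z T))%N.
  apply: rank_le_ker => u ZTu; rewrite -Z0 ZE.
  apply: (@linear_flow_injective R m T Om f T0 Oo Cf1 (h x)
    (fun t => \sum_i u i 0 *: y x i t)).
  - exact: hsol.
  - exact: solves_on_lincomb.
  - by rewrite -ZE.
have Zfree : row_free (Z T) by rewrite /row_free eqn_leq rank_leq_row -[X in (X <= _)%N]rW.
have WtZ : Wt *m Z T = 0.
  apply/matrixP => r i; rewrite (ord1 r) [RHS]mxE.
  have := congr1 (fun v : 'cV[R]_n => v i 0) gr0; rewrite !mxE neural_ode_derive// => H.
  by rewrite -[RHS]H !mxE; apply: eq_bigr => j _; rewrite !mxE.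
have /eqP := WtZ; rewrite mulmx_free_eq0// => /eqP Wt0.
by move: rWt; rewrite Wt0 mxrank0.
Qed.

End neural_ode.

Lemma NODE_N_regular (R : realType) (T : R) (hT : 0 < T) (n k : nat)
    (X : set 'cV[R]_n) (hX : open X) (Phi : 'cV[R]_n -> R) :
  NODE_N T k.+1 X Phi -> Ck k.+1 X Phi /\ forall x, X x -> grad Phi x <> 0.
Proof.
move=> [m [W [b [Wt [bt [[Omt [Omh [f [I [h [Oo Cf AO hsol PhiE]]]]]] mn rW rWt]]]]]].
(* Indexing solutions by the input makes the open set [X] the parameter space and puts [W] into the
   initial condition. *)
pose g x t := h (W *m x + b) t.
have gsol x : X x -> solves_on T (fun t v => f (t, v)) (g x) /\
    forall t : R, t \in `[0, T]%R -> (Omt `*` Omh) (t, g x t).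
  move=> Xx; have [|[[_ _ _ _ hd] _] TI] := hsol (W *m x + b); first by exists x.
  have It (t : R) : t \in `[0, T]%R -> I (W *m x + b) t.
    by rewrite in_itv/= => tT; exact: TI.
  split; last by move=> t /It/hd[].
  split; last by move=> t /subitv_oo_cc/It/hd[].
  (* The open interval of existence contains [0, T], so the solution is differentiable, hence
     continuous, up to both endpoints. *)
  by apply: derivable_within_continuous => t /It/hd[_ _ []].
have g0 x : X x -> g x 0 = W *m x + b.
  by move=> Xx; have [|[[]]] := hsol (W *m x + b); first by exists x.
have T0 := ltW hT.
split; first exact: (neural_ode_Ck T0 hX Oo Cf gsol g0 PhiE).
by move=> x; exact: (neural_ode_no_critical_point T0 hX Oo Cf gsol g0 PhiE rW rWt).
Qed.

Theorem theorem4p11 (R : realType) (T : R) (hT : 0 < T) (n k : nat)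
    (hk : (1 <= k)%N) (X : set 'cV[R]_n) (hX : open X) :
  [/\ (forall Phi : 'cV[R]_n -> R, NODE_N T k X Phi ->
         forall x : 'cV[R]_n, X x -> ~ critical_point Phi x),
      NODE_N T k X `<=` C1class k X &
      (2 <= k)%N ->
        forall Phi : 'cV[R]_n -> R, NODE_N T k X Phi -> morse X Phi].
Proof.
case: k hk => // k _; have reg := NODE_N_regular hT hX.
split=> [Phi /reg[]//|Phi /reg//|k2 Phi /reg[PhiCk noCrit]].
(* Without critical points the Hessian condition is vacuous; the bound on [k] serves for [Ck 2]. *)
by split; [exact: Ck_along_le PhiCk|move=> x Xx /noCrit].
Qed.
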